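(* Let $1\le s\le n$ be such that $\mathfrak R(n,s)\ne\emptyset$. If $(\Gamma,v)$ is an element of $\mathfrak R(n,s)$ taken uniformly at random, then $\mathrm{silh}(\Gamma,v)$ is a uniformly random element of $\mathfrak D(s,s)$. That is, for any $\Delta,\Delta'\in\mathfrak D(s,s)$, $$\mathbb P(\mathrm{silh}(\Gamma,v)=\Delta)=\mathbb P(\mathrm{silh}(\Gamma,v)=\Delta'),$$ where $(\Gamma,v)$ is the $\mathfrak R(n,s)$-valued random variable with uniform distribution.
   Context: Consider finite connected graphs with undirected $a$-edges and directed $b$-edges such that: every vertex lies on at most one $a$-edge, which is either an $a$-loop or an isolated $a$-edge (joining two distinct vertices); the $b$-edges form a partial injective map on vertices, and each $b$-edge is a $b$-loop, or an isolated $b$-edge (joining two distinct vertices lying on no other $b$-edge), or one of the edges of a $b$-triangle (a directed 3-cycle on three distinct vertices). Such a graph is $\mathrm{PSL}_2(\mathbb Z)$-cyclically reduced if every vertex is adjacent to an $a$-edge and to a $b$-edge; a rooted such graph $(\Gamma,v)$ is $\mathrm{PSL}_2(\mathbb Z)$-reduced if every vertex except possibly the root $v$ is adjacent to an $a$-edge and to a $b$-edge. The rooted graph with one vertex and no edge is excluded from consideration. The size of a graph is its number of vertices. It is labeled if its vertex set of size $n$ is $[n]=\{1,\dots,n\}$, and quasi-labeled if its vertices are distinct positive integers. $\mathrm{norm}(\Gamma)$ is the labeled graph obtained from a quasi-labeled graph by the order-preserving relabeling onto $\{1,\dots,|\Gamma|\}$. Special graphs: $\Delta_1$ has one vertex carrying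 an $a$-loop and a $b$-loop; $\Delta_2$ has two vertices joined by an isolated $a$-edge and by an isolated $b$-edge; $\Delta_3$ has two vertices joined by an isolated $b$-edge, each carrying an $a$-loop. Moves on a quasi-labeled cyclically reduced graph (deleting a vertex also deletes its adjacent edges): - $\lambda_3$: if $v$ carries a $b$-loop and an isolated $a$-edge joins $v$ to $w\ne v$, delete $v$ and add an $a$-loop at $w$. - $\lambda_{2,1}$: if $v$ carries an $a$-loop and lies on a $b$-triangle $w\to v\to w'\to w$, delete $v$ (the $b$-edge $w'\to w$ becomes isolated). - $\lambda_{2,2}$: if $v$ carries an $a$-loop, an isolated $b$-edge (of either orientation) joins $v$ and $w\ne v$, and an isolated $a$-edge joins $w$ to $w'\notin\{v,w\}$, delete $v$ and $w$ and add an $a$-loop at $w'$. - $\kappa_3$: if there is an isolated $b$-edge $v\to w$, and isolated $a$-edges join $v$ to $v'$ and $w$ to $w'$ with $v,w,v',w'$ pairwise distinct, delete $v$ and $w$ and add an isolated $a$-edge between $v'$ and $w'$. - $\mathrm{exc}$: if the graph is $\Delta_3$ with $b$-edge $v\to w$, replace it by $\Delta_1$ with vertex $v$. The quasi-silhouette $\mathrm{q\text{-}silh}(\Gamma)$ of a labeled cyclically reduced graph $\Gamma$ is the quasi-labeled graph obtained by applying a maximal sequence of moves. The result does not depend on the sequence, except for the vertex labels in two situations, where the following conventions are adopted: if $\Gamma$ is a $b$-triangle with three $a$-loops, the first $\lambda_{2,1}$-move keeps the $b$-edge with maximal start vertex; if $\Gamma$ is a single cycle alternating $a$-edges and isolated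 $b$-edges (with at least two $b$-edges), the $\kappa_3$-moves eliminate all $b$-edges except the one with maximal start vertex. These lead to $\Delta_1$ and $\Delta_2$ respectively. The silhouette is $\mathrm{silh}(\Gamma)=\mathrm{norm}(\mathrm{q\text{-}silh}(\Gamma))$. For a labeled rooted $\mathrm{PSL}_2(\mathbb Z)$-reduced graph $(\Gamma,v)$, let $\mathrm{unroot}(\Gamma,v)$ be the labeled cyclically reduced graph obtained by forgetting the root and, if $v$ is not adjacent to an $\alpha$-edge for $\alpha=a$ or $\alpha=b$, adding an $\alpha$-loop at $v$; the (quasi-)silhouette of $(\Gamma,v)$ is the (quasi-)silhouette of $\mathrm{unroot}(\Gamma,v)$. $\mathfrak R(n,s)$ is the set of size $n$ labeled $\mathrm{PSL}_2(\mathbb Z)$-reduced rooted graphs whose silhouette has $s$ vertices, and $\mathfrak D(s,s)$ is the set of labeled silhouettes of size $s$ (the labeled cyclically reduced graphs of size $s$ equal to their own silhouette). Convention: the silhouettes $\Delta_1$ and $\Delta_2$ are considered without regard to their vertex labels, so that there is exactly one silhouette of size 1 and exactly one of size 2. *)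

(* Defs.v *)
From HB Require Import structures.
From mathcomp Require Import all_boot all_order all_algebra.

Set Implicit Arguments.
Unset Strict Implicit.
Unset Printing Implicit Defensive.

(* Quasi-labeled (pre)graphs whose vertices are taken in the ordered label set
   'I_N (labels start at 0 rather than at 1; only their order matters).
   An undirected a-edge between x and y is stored as both (x, y) and (y, x);
   the b-edge x -> y is stored as (x, y). *)
Record qgraph (N : nat) := QGraph {
  vertices : {set 'I_N};
  aedges : {set 'I_N * 'I_N};
  bedges : {set 'I_N * 'I_N} }.

Definition qgraph_code N (G : qgraph N) := (vertices G, aedges G, bedges G).
Definition qgraph_decode N
    (t : {set 'I_N} * {set 'I_N * 'I_N} * {set 'I_N * 'I_N}) : qgraph N :=
  QGraph t.1.1 t.1.2 t.2.
Lemma qgraph_codeK N : cancel (@qgraph_code N) (@qgraph_decode N).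
Proof. by case. Qed.
HB.instance Definition _ N := Finite.copy (qgraph N) (can_type (@qgraph_codeK N)).

Section Graphs.
Variable N : nat.
Implicit Types (G H : qgraph N) (x y z u v w : 'I_N).

Definition aedge G x y := (x, y) \in aedges G.
Definition bedge G x y := (x, y) \in bedges G.

Definition aloop G x := aedge G x x.
Definition bloop G x := bedge G x x.

(* In a graph, where each vertex lies on at most one a-edge, an a-edge between
   distinct vertices is isolated. *)
Definition iso_a G x y := (x != y) && aedge G x y.

Definition iso_b G x y :=
  [&& x != y, bedge G x y &
   [forall u, forall w, bedge G u w ==>
     [|| u == x, u == y, w == x | w == y] ==> (u == x) && (w == y)]].

Definition btriangle G x y z :=
  [&& uniq [:: x; y; z], bedge G x y, bedge G y z & bedge G z x].

Definition adjacent G x y := [|| aedge G x y, bedge G x y | bedge G y x].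

Definition connected G :=
  [forall x in vertices G, forall y in vertices G, connect (adjacent G) x y].

Definition is_graph G :=
  [&& vertices G != set0,
      [forall x, forall y, aedge G x y ==>
        [&& x \in vertices G, y \in vertices G & aedge G y x]],
      [forall x, forall y, bedge G x y ==>
        (x \in vertices G) && (y \in vertices G)],
      [forall x, forall y, forall z, aedge G x y ==> aedge G x z ==> (y == z)],
      [forall x, forall y, forall z, bedge G x y ==> bedge G x z ==> (y == z)],
      [forall x, forall y, forall z, bedge G x z ==> bedge G y z ==> (x == y)],
      [forall x, forall y, bedge G x y ==>
        [|| x == y, iso_b G x y | [exists z, btriangle G x y z]]] &
      connected G].

Definition has_aedge G x := [exists y, aedge G x y].
Definition has_bedge G x := [exists y, bedge G x y || bedge G y x].

Definition cyclically_reduced G :=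
  is_graph G && [forall x in vertices G, has_aedge G x && has_bedge G x].

(* The last conjunct excludes the rooted graph with one vertex and no edge. *)
Definition rooted_reduced G v :=
  [&& is_graph G, v \in vertices G,
      [forall x in vertices G, (x != v) ==> has_aedge G x && has_bedge G x] &
      ~~ [&& #|vertices G| == 1, aedges G == set0 & bedges G == set0]].

Definition labeled G := vertices G == setT.

Definition Delta1 v : qgraph N :=
  QGraph [set v] [set (v, v)] [set (v, v)].
Definition Delta2 v w : qgraph N :=
  QGraph [set v; w] [set (v, w); (w, v)] [set (v, w)].
Definition Delta3 v w : qgraph N :=
  QGraph [set v; w] [set (v, v); (w, w)] [set (v, w)].

Definition del G (X : {set 'I_N}) : qgraph N :=
  QGraph (vertices G :\: X)
    [set e in aedges G | (e.1 \notin X) && (e.2 \notin X)]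
    [set e in bedges G | (e.1 \notin X) && (e.2 \notin X)].

Definition add_a G x y : qgraph N :=
  QGraph (vertices G) (aedges G :|: [set (x, y); (y, x)]) (bedges G).

Definition lambda3 G H :=
  [exists v, exists w,
    [&& bloop G v, iso_a G v w & H == add_a (del G [set v]) w w]].

Definition lambda21 G H :=
  [exists v, exists w, exists w',
    [&& aloop G v, btriangle G w v w' & H == del G [set v]]].

Definition lambda22 G H :=
  [exists v, exists w, exists w',
    [&& aloop G v, iso_b G v w || iso_b G w v, iso_a G w w',
        w' != v, w' != w & H == add_a (del G [set v; w]) w' w']].

Definition kappa3 G H :=
  [exists v, exists w, exists v', exists w',
    [&& iso_b G v w, iso_a G v v', iso_a G w w', uniq [:: v; w; v'; w']
      & H == add_a (del G [set v; w]) v' w']].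

Definition exc G H :=
  [exists v, exists w, [&& v != w, G == Delta3 v w & H == Delta1 v]].

Definition move G H :=
  [|| lambda3 G H, lambda21 G H, lambda22 G H, kappa3 G H | exc G H].

(* For a connected G: a single b-triangle with three a-loops. *)
Definition looped_triangle G :=
  [forall x in vertices G,
    aloop G x && [exists y, exists z, btriangle G x y z]].

(* For a connected G: a single cycle alternating a-edges and isolated b-edges. *)
Definition alternating_cycle G :=
  [forall x in vertices G,
    [exists y, iso_a G x y] && [exists y, iso_b G x y || iso_b G y x]].

Definition keeps_max_bedge G H :=
  [exists x, exists y,
    [&& bedge G x y, [forall u, forall w, bedge G u w ==> (u <= x)]
      & bedge H x y]].

(* The two label conventions are imposed at every step; once the b-edge with
   maximal start vertex of an alternating cycle is kept by a kappa3-move, it is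
   again the one with maximal start vertex of the resulting cycle. *)
Definition conv_move G H :=
  move G H &&
  (looped_triangle G || alternating_cycle G ==> keeps_max_bedge G H).

Definition is_qsilh G H := connect conv_move G H && ~~ [exists H', move H H'].

(* Whenever several maximal sequences give distinct quasi-silhouettes, these
   differ only by the vertex labels of Delta1 or Delta2, which are
   disregarded below. *)
Definition qsilh G : qgraph N := odflt G [pick H | is_qsilh G H].

(* enum_val is increasing on a set of ordinals. *)
Definition norm G : qgraph #|vertices G| :=
  QGraph [set: 'I_#|vertices G|]
    [set e | aedge G (enum_val e.1) (enum_val e.2)]
    [set e | bedge G (enum_val e.1) (enum_val e.2)].

(* The size of the silhouette is part of its value. *)
Definition silh G : {k : nat & qgraph k} := Tagged qgraph (norm (qsilh G)).

(* Both loops can be missing only on the excluded graph. *)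
Definition unroot G v : qgraph N :=
  QGraph (vertices G)
    (if has_aedge G v then aedges G else (v, v) |: aedges G)
    (if has_bedge G v then bedges G else (v, v) |: bedges G).

Definition rooted_silh (g : qgraph N * 'I_N) : {k : nat & qgraph k} :=
  silh (unroot g.1 g.2).

Definition is_Delta1 G := [exists v, G == Delta1 v].
Definition is_Delta2 G := [exists v, exists w, (v != w) && (G == Delta2 v w)].

End Graphs.

(* Equality of silhouettes: Delta1 and Delta2 are considered without regard to
   their vertex labels. *)
Definition same_silh (X Y : {k : nat & qgraph k}) :=
  [|| X == Y, is_Delta1 (tagged X) && is_Delta1 (tagged Y)
    | is_Delta2 (tagged X) && is_Delta2 (tagged Y)].

Definition Rset (n s : nat) : {set qgraph n * 'I_n} :=
  [set g | [&& labeled g.1, rooted_reduced g.1 g.2 & tag (rooted_silh g) == s]].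

Definition Dset (s : nat) : {set qgraph s} :=
  [set G | [&& labeled G, cyclically_reduced G
             & silh G == Tagged qgraph G]].

Definition unif_prob (T : finType) (S : {set T}) (E : pred T) : rat :=
  (#|[set x in S | E x]|%:R / #|S|%:R)%R.

(* Main.v *)
(* The flow system [solution] is preserved by every move: solutions
   restrict to the smaller graph, and every solution of the smaller graph
   extends.  Since a flow dies out at the loops, a b-triangle carrying a flow
   that vanishes at none of its vertices is never destroyed.  A normal form with
   at least 3 vertices consists of b-triangles and isolated a-edges only, so it
   carries nowhere vanishing flows with enough freedom to recover its vertices,
   its b-triangles and its a-edges from the flows of the original graph.

   Given two such silhouettes D and D' of size s, a permutation p maps the perfect
   matching formed by the a-edges of D' to that of D.  In a graph with silhouette
   D, permute the a-edges along p at the vertices surviving in the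
   quasi-silhouette, and replace the b-triangles on these vertices by those of
   D'.  Nowhere vanishing flows correspond to each other under this operation, so
   the result has silhouette D' with the same surviving vertices.  The operation
   is therefore injective, and exchanging D and D' gives equal cardinalities. *)

Require Import Defs.
From mathcomp Require Import all_boot all_order all_algebra perm.

Set Implicit Arguments.
Unset Strict Implicit.
Unset Printing Implicit Defensive.

(** The quasi-silhouette is only one chosen normal form, and the moves available in the modified
    graph need not follow those of the original one. An a-edge of the quasi-silhouette need not be
    an edge of the original graph, since it may stand for a path through deleted vertices. This is
    why a-edges are permuted, while b-triangles, which are already triangles of the original graph,
    can be replaced outright. Two global properties have to survive the exchange. Connectedness is
    obtained from the first component of a solution, which is free on the exchanged triangles. The
    root stays in place, because the loops added by [unroot] kill flows and so never sit on a
    surviving vertex. For sizes 1 and 2 nothing is exchanged: silhouettes of that size are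
    identified, and the two events coincide. *)

Lemma connect_step_ind (T : finType) (e : rel T) (P : T -> T -> Prop) :
  (forall x, P x x) ->
  (forall x y z, e x y -> connect e y z -> P y z -> P x z) ->
  forall x z, connect e x z -> P x z.
Proof.
move=> P0 PS x z /connectP[s]; elim: s x => [|y s IH] x /=; first by move=> _ ->.
case/andP=> exy pth lst; apply: PS exy _ _; last exact: IH.
by apply/connectP; exists s.
Qed.

Section Moves.
Variable N : nat.
Implicit Types (G H : qgraph N) (x y z u v w : 'I_N) (f : 'I_N -> nat * nat).

Notation reach := (connect (@move N)).

(** * Flows and moves *)

(** The part of [is_graph] that is checked edge by edge. Connectedness is kept apart because its
    preservation under moves needs a global argument. *)
Record local_graph G : Prop := LocalGraph {
  a_in : forall x y, aedge G x y -> x \in vertices G;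
  a_sym : forall x y, aedge G x y -> aedge G y x;
  a_fun : forall x y z, aedge G x y -> aedge G x z -> y = z;
  b_inl : forall x y, bedge G x y -> x \in vertices G;
  b_inr : forall x y, bedge G x y -> y \in vertices G;
  b_fun : forall x y z, bedge G x y -> bedge G x z -> y = z;
  b_inj : forall x y z, bedge G x z -> bedge G y z -> x = y;
  b_type : forall x y, bedge G x y ->
    [\/ x = y, iso_b G x y | exists z, btriangle G x y z] }.

Definition edge_invariant G (h : 'I_N -> nat) :=
  (forall x y, aedge G x y -> h x = h y) /\
  (forall x y, bedge G x y -> h x = h y).

(** Connectedness in dual form. Functions constant along edges can be restricted and extended
    through moves like solutions, whereas paths would have to be rerouted. *)
Definition conn G := forall h, edge_invariant G h ->
  {in vertices G &, forall x y, h x = h y}.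

Record total_graph G : Prop := TotalGraph {
  total_a : forall x, x \in vertices G -> exists y, aedge G x y;
  total_b : forall x, x \in vertices G ->
    exists y, bedge G x y \/ bedge G y x }.

Record reduced G : Prop := Reduced {
  red_local : local_graph G;
  red_total : total_graph G;
  red_conn : conn G;
  red_ne : vertices G != set0 }.

Lemma iso_bP G x y :
  reflect [/\ x != y, bedge G x y & forall u w, bedge G u w ->
    [\/ u = x, u = y, w = x | w = y] -> u = x /\ w = y] (iso_b G x y).
Proof.
apply: (iffP and3P) => [[xy bxy /forallP h]|[xy bxy h]]; split=> //.
  move=> u w buw t; have /forallP/(_ w) := h u.
  rewrite buw /= => /implyP h'.
  have /andP[/eqP-> /eqP->] // : (u == x) && (w == y).
  by apply: h'; case: t => ->; rewrite eqxx ?orbT.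
apply/forallP => u; apply/forallP => w; apply/implyP => buw; apply/implyP => t.
have [|-> ->] := h u w buw; last by rewrite !eqxx.
by case/or4P: t => /eqP ->; [constructor 1|constructor 2|constructor 3|constructor 4].
Qed.

Lemma btriangleP G x y z :
  reflect [/\ [/\ x != y, y != z & x != z],
              bedge G x y, bedge G y z & bedge G z x] (btriangle G x y z).
Proof.
rewrite /btriangle /= !inE negb_or !andbT.
by apply: (iffP and4P) => [[/andP[/andP[-> ->] ->] -> -> ->]|
  [[-> -> ->] -> -> ->]].
Qed.

Lemma btriangle_rot G x y z : btriangle G x y z -> btriangle G y z x.
Proof.
case/btriangleP => [[xy yz xz] b1 b2 b3]; apply/btriangleP.
by split=> //; split=> //; rewrite eq_sym.
Qed.

Lemma iso_b_not_triangle G x y z : iso_b G x y -> ~ btriangle G x y z.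
Proof.
case/iso_bP => xy bxy h /btriangleP[[_ yz _] _ byz _].
have [|yx _] := h _ _ byz; first by constructor 2.
by rewrite yx eqxx in xy.
Qed.

Lemma adjacent_sym G : local_graph G -> symmetric (adjacent G).
Proof.
move=> lG x y; rewrite /adjacent [bedge G y x || _]orbC.
by congr (_ || _); apply/idP/idP => /(a_sym lG).
Qed.

Lemma connP G : local_graph G -> reflect (conn G) (connected G).
Proof.
move=> lG; apply: (iffP idP).
  move=> /forallP cG h [ha hb] x y xV yV.
  have /implyP/(_ xV)/forallP/(_ y)/implyP/(_ yV)/connectP[p] := cG x.
  elim: p x {xV} => [|z p IH] x /=; first by move=> _ ->.
  case/andP=> /or3P adj pth lst; rewrite -(IH z pth lst).
  by case: adj => [/ha|/hb|/hb].
move=> cG; apply/forallP => x; apply/implyP => xV.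
apply/forallP => y; apply/implyP => yV.
have cl z t : adjacent G z t ->
    connect (adjacent G) x z = connect (adjacent G) x t.
  move=> zt; apply: same_connect_r; last exact: connect1.
  exact/sym_connect_sym/adjacent_sym.
have inv : edge_invariant G (fun z => nat_of_bool (connect (adjacent G) x z)).
  by split=> z t e; congr nat_of_bool; apply: cl; rewrite /adjacent e ?orbT.
by have := cG _ inv x y xV yV; rewrite connect0; case: (connect _ x y).
Qed.

Lemma local_graphP G :
  reflect [/\ local_graph G, conn G & vertices G != set0] (is_graph G).
Proof.
apply: (iffP and5P).
  case=> ne /forallP A1 /forallP B1 /forallP A2.
  case/and4P=> /forallP B2 /forallP B3 /forallP B4 C.
  have lG : local_graph G.
    split.
    - by move=> x y e; have /forallP/(_ y)/implyP/(_ e)/and3P[] := A1 x.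
    - by move=> x y e; have /forallP/(_ y)/implyP/(_ e)/and3P[] := A1 x.
    - move=> x y z e e'; have /forallP/(_ y)/forallP/(_ z) := A2 x.
      by rewrite e e' => /eqP.
    - by move=> x y e; have /forallP/(_ y)/implyP/(_ e)/andP[] := B1 x.
    - by move=> x y e; have /forallP/(_ y)/implyP/(_ e)/andP[] := B1 x.
    - move=> x y z e e'; have /forallP/(_ y)/forallP/(_ z) := B2 x.
      by rewrite e e' => /eqP.
    - move=> x y z e e'; have /forallP/(_ y)/forallP/(_ z) := B3 x.
      by rewrite e e' => /eqP.
    - move=> x y e; have /forallP/(_ y)/implyP/(_ e)/or3P := B4 x.
      by case=> [/eqP|?|/existsP]; [constructor 1|constructor 2|constructor 3].
  by split=> //; apply/connP.
case=> lG cG ne; split=> //; last (apply/and4P; split).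
- apply/forallP => x; apply/forallP => y; apply/implyP => e.
  by rewrite (a_in lG e) (a_in lG (a_sym lG e)) (a_sym lG e).
- apply/forallP => x; apply/forallP => y; apply/implyP => e.
  by rewrite (b_inl lG e) (b_inr lG e).
- apply/forallP => x; apply/forallP => y; apply/forallP => z.
  by apply/implyP => e; apply/implyP => e'; apply/eqP/(a_fun lG e e').
- apply/forallP => x; apply/forallP => y; apply/forallP => z.
  by apply/implyP => e; apply/implyP => e'; apply/eqP/(b_fun lG e e').
- apply/forallP => x; apply/forallP => y; apply/forallP => z.
  by apply/implyP => e; apply/implyP => e'; apply/eqP/(b_inj lG e e').
- apply/forallP => x; apply/forallP => y; apply/implyP => e.
  by case: (b_type lG e) => [->|->|/existsP ->]; rewrite ?eqxx ?orbT.
- exact/connP.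
Qed.

Lemma has_bedgeP G x :
  reflect (exists y, bedge G x y \/ bedge G y x) (has_bedge G x).
Proof. by apply: (iffP existsP) => -[y e]; exists y; apply/orP. Qed.

Lemma reducedP G : reflect (reduced G) (cyclically_reduced G).
Proof.
apply: (iffP andP) => [[/local_graphP[lG cG ne] /forallP t]|[lG [ta tb] cG ne]].
  by split=> //; split=> x xV;
    have /implyP/(_ xV)/andP[/existsP ? /has_bedgeP ?] := t x.
split; first exact/local_graphP.
apply/forallP => x; apply/implyP => xV; apply/andP; split.
  exact/existsP/ta.
exact/has_bedgeP/tb.
Qed.

Lemma eq_qgraph G H : vertices G = vertices H -> aedge G =2 aedge H ->
  bedge G =2 bedge H -> G = H.
Proof.
case: G H => [V a b] [V' a' b'] /= -> ea eb; congr QGraph; apply/setP.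
  by case=> x y; apply: ea.
by case=> x y; apply: eb.
Qed.

Definition nonnormal G := [exists H, move G H].

(* The second component of [f] is a flow.  The first one is constant along the
   edges, except on the b-triangles where the flow vanishes nowhere; there [f] is
   unconstrained.  It serves to prove connectivity. *)
Record solution G f : Prop := Solution {
  sol_a : forall x y, aedge G x y -> f x = f y;
  sol_aloop : forall x, aloop G x -> (f x).2 = 0;
  sol_bloop : forall x, bloop G x -> (f x).2 = 0;
  sol_iso : forall x y, iso_b G x y -> f x = f y;
  sol_tri : forall x y z, btriangle G x y z -> (f x).2 = 0 ->
    f y = f z /\ (f x).1 = (f y).1 }.

(* The moves lambda3 and lambda22 are the case p = q, kappa3 the case p <> q. *)
Record surgery G (X : {set 'I_N}) p q : Prop := Surgery {
  srg_b : forall x y, bedge G x y -> (x \in X) = (y \in X);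
  srg_pV : p \in vertices G;
  srg_qV : q \in vertices G;
  srg_p : p \notin X;
  srg_q : q \notin X;
  srg_sub : X \subset vertices G;
  srg_ne : X != set0;
  srg_a : forall x y, aedge G x y -> x \notin X -> y \in X -> x = p \/ x = q;
  srg_ap : forall y, aedge G p y -> y \in X;
  srg_aq : forall y, aedge G q y -> y \in X;
  srg_tri : forall x y z, btriangle G x y z -> x \notin X;
  srg_loop : p != q -> forall x, x \in X -> ~~ aloop G x /\ ~~ bloop G x;
  srg_sol : forall f, solution G f ->
    [/\ {in X, forall x, f x = f p}, f p = f q & p = q -> (f p).2 = 0] }.

Lemma surgery_aedge G X p q x y :
  aedge (add_a (del G X) p q) x y =
  [|| [&& aedge G x y, x \notin X & y \notin X],
      (x == p) && (y == q) | (x == q) && (y == p)].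
Proof. by rewrite /aedge !inE. Qed.

Lemma surgery_bedge G X p q x y :
  bedge (add_a (del G X) p q) x y = [&& bedge G x y, x \notin X & y \notin X].
Proof. by rewrite /bedge !inE. Qed.

Lemma del_aedge G X x y :
  aedge (del G X) x y = [&& aedge G x y, x \notin X & y \notin X].
Proof. by rewrite /aedge !inE. Qed.

Lemma del_bedge G X x y :
  bedge (del G X) x y = [&& bedge G x y, x \notin X & y \notin X].
Proof. by rewrite /bedge !inE. Qed.

Lemma iso_aP G x y : reflect (x != y /\ aedge G x y) (iso_a G x y).
Proof. exact: andP. Qed.

Lemma iso_b_mono G H x y : (forall u w, bedge H u w -> bedge G u w) ->
  bedge H x y -> iso_b G x y -> iso_b H x y.
Proof.
move=> sub e /iso_bP[xy _ h]; apply/iso_bP; split=> // u w /sub.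
exact: h.
Qed.

(** * Moves that delete a set and rejoin its a-neighbours *)

Section Surgery.
Variables (G : qgraph N) (X : {set 'I_N}) (p q : 'I_N).
Hypotheses (lG : local_graph G) (tG : total_graph G) (sG : surgery G X p q).
Let H := add_a (del G X) p q.

Lemma surgery_local : local_graph H.
Proof.
have old x y : [&& aedge G x y, x \notin X & y \notin X] ->
    x <> p /\ x <> q.
  case/and3P=> e _ /negP yX; split=> E; subst x.
    by have := srg_ap sG e.
  by have := srg_aq sG e.
split=> [x y|x y|x y z|x y|x y|x y z|x y z|x y];
  rewrite ?surgery_aedge ?surgery_bedge.
- rewrite !inE => /or3P[/and3P[e xX _]|/andP[/eqP-> _]|/andP[/eqP-> _]].
  + by rewrite xX (a_in lG e).
  + by rewrite (srg_p sG) (srg_pV sG).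
  + by rewrite (srg_q sG) (srg_qV sG).
- case/or3P => [/and3P[/(a_sym lG) -> -> -> //]|/andP[-> ->]|/andP[-> ->]];
  by rewrite ?orbT.
- case/or3P => [o|/andP[/eqP-> /eqP->]|/andP[/eqP-> /eqP->]].
  + have [xp xq] := old _ _ o; case/or3P=> [o'|/andP[/eqP]|/andP[/eqP]] //.
    by case/and3P: o => o _ _; case/and3P: o' => o' _ _; apply: (a_fun lG o).
  + by case/or3P=> [/old[]|/andP[_ /eqP]|/andP[/eqP-> /eqP]].
  + by case/or3P=> [/old[]|/andP[/eqP-> /eqP]|/andP[_ /eqP]].
- by case/and3P => e xX _; rewrite !inE xX (b_inl lG e).
- by case/and3P => e _ yX; rewrite !inE yX (b_inr lG e).
- by case/and3P => e _ _ /and3P[e' _ _]; apply: (b_fun lG e).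
- by case/and3P => e _ _ /and3P[e' _ _]; apply: (b_inj lG e).
- case/and3P => e xX yX; case: (b_type lG e) => [->|i|[z t]].
  + by constructor 1.
  + constructor 2; apply: iso_b_mono i; last by rewrite surgery_bedge e xX.
    by move=> u w; rewrite surgery_bedge => /and3P[].
  + constructor 3; exists z; have zX : z \notin X.
      by apply: (srg_tri sG (btriangle_rot (btriangle_rot t))).
    case/btriangleP: t => ne e1 e2 e3; apply/btriangleP.
    by split=> //; rewrite surgery_bedge ?xX ?yX ?zX ?e1 ?e2 ?e3.
Qed.

Lemma surgery_total : total_graph H.
Proof.
split=> x; rewrite !inE => /andP[xX xV].
  have [->|xp] := eqVneq x p.
    by exists q; rewrite surgery_aedge !eqxx orbT.
  have [->|xq] := eqVneq x q.
    by exists p; rewrite surgery_aedge !eqxx !orbT.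
  have [y e] := total_a tG xV; exists y; rewrite surgery_aedge e xX /=.
  case: (boolP (y \in X)) => // yX.
  have [E|E] := srg_a sG e xX yX.
    by rewrite E eqxx in xp.
  by rewrite E eqxx in xq.
have [y e] := total_b tG xV; exists y; rewrite !surgery_bedge.
have <- : (x \in X) = (y \in X) by case: e => /(srg_b sG).
by case: e => ->; rewrite xX; [left|right].
Qed.

(** The only new constraints come from the new a-edge, and [srg_sol] is exactly what they ask. As
    [X] is a union of b-components, a b-edge isolated in [H] was isolated in [G]. *)
Lemma surgery_restrict f : solution G f -> solution H f.
Proof.
move=> sf; have [_ pq p0] := srg_sol sG sf.
split=> [x y|x|x|x y|x y z].
- by rewrite surgery_aedge => /or3P[/and3P[/(sol_a sf)]|/andP[/eqP-> /eqP->]|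
    /andP[/eqP-> /eqP->]].
- rewrite /aloop surgery_aedge => /or3P[/and3P[/(sol_aloop sf)]||] //;
  case/andP=> /eqP E /eqP E'; first by rewrite E p0 // -E.
  by rewrite E' p0 // -E.
- by rewrite /bloop surgery_bedge => /and3P[/(sol_bloop sf)].
- case/iso_bP => xy; rewrite surgery_bedge => /and3P[e xX yX] h.
  apply: (sol_iso sf); apply/iso_bP; split=> // u w e' t.
  apply: h => //; rewrite surgery_bedge e' (srg_b sG e') andbb.
  have <- := srg_b sG e'.
  by case: t => [->|->|E|E] //; rewrite (srg_b sG e') E.
- case/btriangleP => ne; rewrite !surgery_bedge.
  case/and3P=> e1 _ _ /and3P[e2 _ _] /and3P[e3 _ _].
  by apply: (sol_tri sf); apply/btriangleP.
Qed.

(** The deleted vertices take the value at [p], which is also the value at [q] across the new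
    a-edge. If [X] carries a loop, then [p = q], and the new a-loop makes that flow vanish. *)
Lemma surgery_extend f : solution H f ->
  solution G (fun x => if x \in X then f p else f x).
Proof.
move=> sf.
have fpq : f p = f q.
  by apply: (sol_a sf); rewrite surgery_aedge !eqxx orbT.
have fp x : x \in X -> aloop G x || bloop G x -> (f p).2 = 0.
  move=> xX l; case: (eqVneq p q) => pq; last first.
    have [/negPf la /negPf lb] := srg_loop sG pq xX.
    by rewrite la lb in l.
  by apply: (sol_aloop sf); rewrite /aloop surgery_aedge -pq !eqxx orbT.
split=> [x y e|x l|x l|x y i|x y z t].
- case: ifP => xX; case: ifP => yX //.
  + by have [->|->] := srg_a sG (a_sym lG e) (negbT yX) xX.
  + by have [->|->] := srg_a sG e (negbT xX) yX.
  + by apply: (sol_a sf); rewrite surgery_aedge e xX yX.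
- case: ifP => xX; first by rewrite (fp x) // l.
  by apply: (sol_aloop sf); rewrite /aloop surgery_aedge -/(aloop G x) l xX.
- case: ifP => xX; first by rewrite (fp x) // l orbT.
  by apply: (sol_bloop sf); rewrite /bloop surgery_bedge -/(bloop G x) l xX.
- have e : bedge G x y by case/iso_bP: i.
  rewrite -(srg_b sG e); case: ifP => xX //.
  apply: (sol_iso sf); apply: iso_b_mono i.
    by move=> u w; rewrite surgery_bedge => /and3P[].
  by rewrite surgery_bedge e -(srg_b sG e) xX.
- have xX := srg_tri sG t; have yX := srg_tri sG (btriangle_rot t).
  have zX := srg_tri sG (btriangle_rot (btriangle_rot t)).
  rewrite (negPf xX) (negPf yX) (negPf zX); apply: (sol_tri sf).
  case/btriangleP: t => ne e1 e2 e3; apply/btriangleP.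
  by split=> //; rewrite surgery_bedge ?xX ?yX ?zX ?e1 ?e2 ?e3.
Qed.

End Surgery.

(** * The move that opens a b-triangle *)

Section Trim.
Variables (G : qgraph N) (v w w' : 'I_N).
Hypotheses (lG : local_graph G) (tG : total_graph G).
Hypotheses (lv : aloop G v) (tv : btriangle G w v w').
Let H := del G [set v].

Lemma trim_iso_b : iso_b H w' w.
Proof.
case/btriangleP: tv => [[wv vw' ww'] e1 e2 e3]; apply/iso_bP.
rewrite eq_sym; split=> //.
  by rewrite del_bedge e3 !inE wv eq_sym vw'.
move=> x y; rewrite del_bedge !inE => /and3P[e xv yv].
case=> E; subst.
- by rewrite (b_fun lG e e3).
- by rewrite (b_fun lG e e1) eqxx in yv.
- by rewrite (b_inj lG e e2) eqxx in xv.
- by rewrite (b_inj lG e e3).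
Qed.

Lemma trim_iso_b_inv x y : iso_b H x y ->
  [/\ x != v, y != v & iso_b G x y] \/ (x = w' /\ y = w).
Proof.
case/iso_bP => xy; rewrite del_bedge !inE => /and3P[e xv yv] h.
case: (b_type lG e) => [E|i|[z t]]; first by rewrite E eqxx in xy.
  by left.
case: (eqVneq z v) => [E|zv].
  subst z; right; case/btriangleP: t => _ _ b1 b2.
  case/btriangleP: tv => _ b3 b4 _.
  by rewrite (b_inj lG b1 b3) (b_fun lG b2 b4).
case/btriangleP: t => [[_ yz _] _ b1 b2].
have [||E _] := h y z; rewrite ?del_bedge ?inE ?b1 ?yv ?zv //.
  by constructor 2.
by rewrite E eqxx in xy.
Qed.

Lemma trim_triangle x y z : btriangle G x y z ->
  x != v -> y != v -> z != v -> btriangle H x y z.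
Proof.
case/btriangleP => ne e1 e2 e3 xv yv zv; apply/btriangleP.
by split=> //; rewrite del_bedge ?e1 ?e2 ?e3 !inE ?xv ?yv ?zv.
Qed.

Lemma trim_local : local_graph H.
Proof.
split=> [x y|x y|x y z|x y|x y|x y z|x y z|x y];
  rewrite ?del_aedge ?del_bedge.
- by case/and3P => e xX _; rewrite !inE (a_in lG e) andbT -in_set1.
- by case/and3P => /(a_sym lG)-> -> ->.
- by case/and3P => e _ _ /and3P[e' _ _]; apply: (a_fun lG e).
- by case/and3P => e xX _; rewrite !inE (b_inl lG e) andbT -in_set1.
- by case/and3P => e _ xX; rewrite !inE (b_inr lG e) andbT -in_set1.
- by case/and3P => e _ _ /and3P[e' _ _]; apply: (b_fun lG e).
- by case/and3P => e _ _ /and3P[e' _ _]; apply: (b_inj lG e).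
- case/and3P => e xv yv; case: (b_type lG e) => [->|i|[z t]].
  + by constructor 1.
  + constructor 2; apply: iso_b_mono i; last by rewrite del_bedge e xv.
    by move=> u z; rewrite del_bedge => /and3P[].
  + case: (eqVneq z v) => [E|zv].
      constructor 2; subst z; case/btriangleP: t => _ _ b1 b2.
      case/btriangleP: tv => _ b3 b4 _.
      by rewrite (b_inj lG b1 b3) (b_fun lG b2 b4) trim_iso_b.
    by rewrite !inE in xv yv; constructor 3; exists z; apply: trim_triangle.
Qed.

Lemma trim_total : total_graph H.
Proof.
split=> x; rewrite !inE => /andP[xv xV].
  have [y e] := total_a tG xV; exists y; rewrite del_aedge e !inE xv /=.
  apply/eqP=> E; subst y.
  by rewrite (a_fun lG (a_sym lG e) lv) eqxx in xv.
have [_ bw _] := iso_bP _ _ _ trim_iso_b.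
have [y e] := total_b tG xV; have [E|yv] := eqVneq y v; last first.
  by exists y; rewrite !del_bedge !inE yv xv !andbT.
subst y; case/btriangleP: tv => _ b3 b4 _; case: e => e.
  by exists w'; rewrite (b_inj lG e b3); right.
by exists w; rewrite (b_fun lG e b4); left.
Qed.

(** The flow vanishes at the a-loop [v], and [sol_tri] at [v] then gives the equality required by
    the new isolated b-edge. *)
Lemma trim_restrict f : solution G f -> solution H f.
Proof.
move=> sf; have v0 := sol_aloop sf lv.
split=> [x y|x|x|x y|x y z].
- by rewrite del_aedge => /and3P[/(sol_a sf)].
- by rewrite /aloop del_aedge => /and3P[/(sol_aloop sf)].
- by rewrite /bloop del_bedge => /and3P[/(sol_bloop sf)].
- case/trim_iso_b_inv => [[_ _]|[-> ->]]; first exact: (sol_iso sf).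
  by have [] := sol_tri sf (btriangle_rot tv) v0.
- case/btriangleP => ne; rewrite !del_bedge.
  case/and3P=> e1 _ _ /and3P[e2 _ _] /and3P[e3 _ _].
  by apply: (sol_tri sf); apply/btriangleP.
Qed.

(** The isolated b-edge gives [f w' = f w]. With flow 0 at [v], the triangle condition holds from
    [v]; from [w] or [w'] it assumes that the common flow is 0 as well, and then all three values
    agree. *)
Lemma trim_extend f : solution H f ->
  solution G (fun x => if x == v then ((f w).1, 0) else f x).
Proof.
move=> sf; have fw : f w' = f w := sol_iso sf trim_iso_b.
have [[wv vw' ww'] b1 b2 b3] := btriangleP _ _ _ _ tv.
split=> [x y e|x l|x l|x y i|x y z t].
- have [E|xv] := eqVneq x v; have [E'|yv] := eqVneq y v; subst=> //.
  + by rewrite (a_fun lG lv e) eqxx in yv.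
  + by rewrite (a_fun lG lv (a_sym lG e)) eqxx in xv.
  + by apply: (sol_a sf); rewrite del_aedge e !inE xv.
- case: ifP => xv //=.
  by apply: (sol_aloop sf); rewrite /aloop del_aedge -/(aloop G x) l !inE xv.
- case: ifP => xv //=.
  by apply: (sol_bloop sf); rewrite /bloop del_bedge -/(bloop G x) l !inE xv.
- have [E|xv] := eqVneq x v; first subst x.
    case: (iso_b_not_triangle i (z := w)).
    by case/iso_bP: i => _ e _; rewrite (b_fun lG e b2); apply: btriangle_rot.
  have [E|yv] := eqVneq y v; first subst y.
    case: (iso_b_not_triangle i (z := w')).
    by case/iso_bP: i => _ e _; rewrite (b_inj lG e b1).
  apply: (sol_iso sf); apply: iso_b_mono (i).
    by move=> u z; rewrite del_bedge => /and3P[].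
  by case/iso_bP: i => _ e _; rewrite del_bedge e !inE xv yv.
- have tri' := btriangleP _ _ _ _ t; case: tri' => [[n1 n2 n3] e1 e2 e3].
  have [E|xv] := eqVneq x v.
    subst x; rewrite (b_fun lG e1 b2) (b_inj lG e3 b1) /=.
    by rewrite eq_sym (negPf vw') (negPf wv) fw.
  have [E|yv] := eqVneq y v.
    subst y; rewrite (b_fun lG e2 b2) (b_inj lG e1 b1) /=.
    rewrite eq_sym (negPf vw') fw => fw0; split=> //.
    by move: fw0; case: (f w) => a b /= ->.
  have [E|zv] := eqVneq z v.
    subst z; rewrite (b_fun lG e3 b2) (b_inj lG e2 b1) /= fw => fw0.
    by split=> //; move: fw0; case: (f w) => a b /= ->.
  by apply: (sol_tri sf); apply: trim_triangle.
Qed.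

End Trim.

Lemma iso_b_closed G v w x y : iso_b G v w -> bedge G x y ->
  (x \in [set v; w]) = (y \in [set v; w]).
Proof.
case/iso_bP => _ _ h e; apply/idP/idP; rewrite !inE.
  case/orP => /eqP E; have [|_ ->] := h _ _ e; rewrite ?eqxx ?orbT //.
    by constructor 1.
  by constructor 2.
case/orP => /eqP E; have [|-> _] := h _ _ e; rewrite ?eqxx ?orbT //.
  by constructor 3.
by constructor 4.
Qed.

Lemma iso_b_triangle G v w x y z : iso_b G v w -> btriangle G x y z ->
  x \notin [set v; w].
Proof.
move=> i t; rewrite !inE; apply/negP => /orP xvw.
have [_ _ h] := iso_bP _ _ _ i; case/btriangleP: (t) => _ e _ _.
have [|E1 E2] := h _ _ e; last by subst; apply: iso_b_not_triangle i t.
by case: xvw => /eqP; [constructor 1|constructor 2].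
Qed.

Lemma iso_b_no_bloop G v w x : iso_b G v w -> x \in [set v; w] -> ~~ bloop G x.
Proof.
case/iso_bP => vw _ h xvw; apply/negP => l.
have [|E1 E2] := h _ _ l; last by rewrite -E1 E2 eqxx in vw.
by move: xvw; rewrite !inE => /orP[]/eqP; [constructor 1|constructor 2].
Qed.

Lemma surgery_lambda3 G v w : local_graph G -> bloop G v -> iso_a G v w ->
  surgery G [set v] w w.
Proof.
move=> lG bv /iso_aP[vw e]; have e' := a_sym lG e.
have wv : w \notin [set v] by rewrite inE eq_sym.
split=> //; rewrite ?(a_in lG e') ?sub1set ?(a_in lG e) //.
- move=> x y b; rewrite !inE; apply/eqP/eqP => E; subst.
    exact: (b_fun lG b bv).
  exact: (b_inj lG b bv).
- by apply/set0Pn; exists v; rewrite inE.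
- by move=> x y exy _; rewrite inE => /eqP E; subst; left;
    exact: (a_fun lG (a_sym lG exy) e).
- by move=> y ewy; rewrite inE (a_fun lG ewy e').
- by move=> y ewy; rewrite inE (a_fun lG ewy e').
- move=> x y z /btriangleP[[xy _ _] b _ _]; rewrite inE; apply/eqP => E; subst.
  by rewrite (b_fun lG b bv) eqxx in xy.
- by rewrite eqxx.
- move=> f sf; have E := sol_a sf e; split=> //.
    by move=> x; rewrite inE => /eqP->.
  by move=> _; rewrite -E (sol_bloop sf).
Qed.

Lemma surgery_lambda22 G v w w' : local_graph G -> aloop G v ->
  iso_b G v w || iso_b G w v -> iso_a G w w' -> w' != v ->
  surgery G [set v; w] w' w'.
Proof.
move=> lG lv i /iso_aP[ww' e] w'v; have e' := a_sym lG e.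
have [a [b [iab Eab]]] : exists a b, iso_b G a b /\ [set v; w] = [set a; b].
  case/orP: i => i; first by exists v, w.
  by exists w, v; rewrite setUC.
have bab : bedge G a b by case/iso_bP: iab.
have wn : w' \notin [set v; w] by rewrite !inE negb_or w'v eq_sym.
split=> //; rewrite ?(a_in lG e') //.
- by move=> x y exy; rewrite Eab (iso_b_closed iab exy).
- rewrite Eab; apply/subsetP => x; rewrite !inE.
  by case/orP => /eqP->; rewrite ?(b_inl lG bab) ?(b_inr lG bab).
- by apply/set0Pn; exists v; rewrite !inE eqxx.
- move=> x y exy xn; rewrite !inE => /orP[]/eqP E; subst.
    by rewrite !inE (a_fun lG (a_sym lG exy) lv) eqxx in xn.
  by left; exact: (a_fun lG (a_sym lG exy) e).
- by move=> y ey; rewrite !inE (a_fun lG ey e') eqxx orbT.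
- by move=> y ey; rewrite !inE (a_fun lG ey e') eqxx orbT.
- by move=> x y z t; rewrite Eab (iso_b_triangle iab t).
- by rewrite eqxx.
- move=> f sf; have E := sol_a sf e.
  have E' : f v = f w by case/orP: i => /(sol_iso sf).
  split=> //; first by move=> x; rewrite !inE => /orP[]/eqP->; rewrite ?E'.
  by rewrite -E -E' (sol_aloop sf).
Qed.

Lemma surgery_kappa3 G v w v' w' : local_graph G -> iso_b G v w ->
  iso_a G v v' -> iso_a G w w' -> uniq [:: v; w; v'; w'] ->
  surgery G [set v; w] v' w'.
Proof.
move=> lG i /iso_aP[vv' e] /iso_aP[ww' e'] u.
have [vw bvw _] := iso_bP _ _ _ i.
move: u; rewrite /= !inE !negb_or !andbT => /and3P[/and3P[_ _ vw'] /andP[wv' _] v'w'].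
split=> //.
- by move=> x y exy; rewrite (iso_b_closed i exy).
- exact: (a_in lG (a_sym lG e)).
- exact: (a_in lG (a_sym lG e')).
- by rewrite !inE negb_or eq_sym vv' eq_sym.
- by rewrite !inE negb_or eq_sym vw' eq_sym.
- by apply/subsetP => x; rewrite !inE => /orP[]/eqP->; [rewrite (a_in lG e)|rewrite (a_in lG e')].
- by apply/set0Pn; exists v; rewrite !inE eqxx.
- move=> x y exy _; rewrite !inE => /orP[]/eqP E; subst.
    by left; exact: (a_fun lG (a_sym lG exy) e).
  by right; exact: (a_fun lG (a_sym lG exy) e').
- by move=> y ey; rewrite !inE (a_fun lG ey (a_sym lG e)) eqxx.
- by move=> y ey; rewrite !inE (a_fun lG ey (a_sym lG e')) eqxx orbT.
- by move=> x y z t; rewrite (iso_b_triangle i t).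
- move=> _ x xX; split; last exact: iso_b_no_bloop i xX.
  apply/negP => l; move: xX; rewrite !inE => /orP[]/eqP E; subst.
    by rewrite (a_fun lG l e) eqxx in vv'.
  by rewrite (a_fun lG l e') eqxx in ww'.
- move=> f sf; have E := sol_a sf e; have E' := sol_a sf e'.
  have E'' := sol_iso sf i.
  split=> [x||E3]; last by rewrite E3 eqxx in v'w'.
    by rewrite !inE => /orP[]/eqP->; rewrite -?E''.
  by rewrite -E E''.
Qed.

Variant move_spec G H : Prop :=
| MoveSurgery X p q of surgery G X p q & H = add_a (del G X) p q
| MoveTrim v w w' of aloop G v & btriangle G w v w' & H = del G [set v]
| MoveExc v w of v != w & G = Delta3 v w & H = Delta1 v.

Lemma moveP G H : local_graph G -> move G H -> move_spec G H.
Proof.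
move=> lG /or4P[||| /orP[|]].
- case/existsP=> v /existsP[w] /and3P[bv i /eqP->].
  exact: MoveSurgery (surgery_lambda3 lG bv i) _.
- case/existsP=> v /existsP[w] /existsP[w'] /and3P[lv t /eqP->].
  exact: MoveTrim lv t _.
- case/existsP=> v /existsP[w] /existsP[w'] /and5P[lv i e n /andP[_ /eqP->]].
  exact: MoveSurgery (surgery_lambda22 lG lv i e n) _.
- case/existsP=> v /existsP[w] /existsP[v'] /existsP[w'].
  case/and5P=> i e e' u /eqP->.
  exact: MoveSurgery (surgery_kappa3 lG i e e' u) _.
- case/existsP=> v /existsP[w] /and3P[vw /eqP E /eqP E'].
  exact: MoveExc vw E E'.
Qed.

Lemma Delta1_aedge v x y : aedge (Delta1 v) x y = (x == v) && (y == v).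
Proof. by rewrite /aedge inE. Qed.

Lemma Delta1_bedge v x y : bedge (Delta1 v) x y = (x == v) && (y == v).
Proof. by rewrite /bedge inE. Qed.

Lemma Delta3_bedge v w x y : bedge (Delta3 v w) x y = (x == v) && (y == w).
Proof. by rewrite /bedge inE. Qed.

Lemma Delta3_aedge v w x y :
  aedge (Delta3 v w) x y = (x == y) && (x \in [set v; w]).
Proof.
rewrite /aedge !inE !xpair_eqE; have [->|xy] := eqVneq x y; first by rewrite !andbb.
by apply/negP => /orP[]/andP[/eqP E /eqP E']; rewrite E E' eqxx in xy.
Qed.

Lemma Delta1_local v : local_graph (Delta1 v).
Proof.
split=> [x y|x y|x y z|x y|x y|x y z|x y z|x y];
  rewrite ?Delta1_aedge ?Delta1_bedge ?inE; try by case/andP.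
- by rewrite andbC.
- by case/andP=> _ /eqP-> /andP[_ /eqP->].
- by case/andP=> _ /eqP-> /andP[_ /eqP->].
- by case/andP=> /eqP-> _ /andP[/eqP-> _].
- by case/andP=> /eqP-> /eqP->; constructor 1.
Qed.

Lemma Delta1_total v : total_graph (Delta1 v).
Proof.
by split=> x; rewrite inE => /eqP->; exists v;
  rewrite ?Delta1_aedge ?Delta1_bedge eqxx; [|left].
Qed.

Lemma Delta1_no_triangle v x y z : ~ btriangle (Delta1 v) x y z.
Proof.
case/btriangleP=> [[xy _ _]]; rewrite Delta1_bedge => /andP[/eqP E /eqP E'].
by rewrite E E' eqxx in xy.
Qed.

Lemma Delta3_no_triangle v w x y z : ~ btriangle (Delta3 v w) x y z.
Proof.
case/btriangleP=> [[xy _ _]]; rewrite !Delta3_bedge.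
by case/andP=> /eqP E /eqP E' /andP[/eqP E'' _]; rewrite E E'' eqxx in xy.
Qed.

Lemma move_local G H : local_graph G -> total_graph G -> move G H ->
  local_graph H /\ total_graph H.
Proof.
move=> lG tG /(moveP lG)[X p q s ->|v w w' lv t ->|v w vw E ->].
- by split; [exact: (surgery_local lG s)|exact: (surgery_total tG s)].
- by split; [exact: (trim_local lG t)|exact: (trim_total lG tG lv t)].
- by split; [apply: Delta1_local|apply: Delta1_total].
Qed.

Lemma move_vertices G H : local_graph G -> move G H ->
  vertices H \proper vertices G.
Proof.
move=> lG /(moveP lG)[X p q s ->|v w w' lv t ->|v w vw -> ->] /=.
- rewrite properEneq subsetDl andbT; apply/eqP => E.
  have /set0Pn[x xX] := srg_ne s.
  by have := subsetP (srg_sub s) x xX; rewrite -E inE xX.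
- rewrite properEneq subsetDl andbT; apply/eqP => E.
  by have := a_in lG lv; rewrite -E !inE eqxx.
- by rewrite properE subUset !sub1set !inE eqxx /= eq_sym.
Qed.

Lemma move_restrict G H f : local_graph G -> move G H ->
  solution G f -> solution H f.
Proof.
move=> lG /(moveP lG)[X p q s ->|v w w' lv t ->|v w vw -> ->] sf.
- exact: surgery_restrict.
- exact: (trim_restrict lG lv t sf).
- have v0 : (f v).2 = 0.
    by apply: (sol_aloop sf); rewrite /aloop Delta3_aedge !inE !eqxx.
  split=> [x y|x|x|x y|x y z].
  + by rewrite Delta1_aedge => /andP[/eqP-> /eqP->].
  + by rewrite /aloop Delta1_aedge => /andP[/eqP-> _].
  + by rewrite /bloop Delta1_bedge => /andP[/eqP-> _].
  + by case/iso_bP => _; rewrite Delta1_bedge => /andP[/eqP-> /eqP->].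
  + by move=> /Delta1_no_triangle.
Qed.

Lemma move_extend G H f : local_graph G -> move G H -> solution H f ->
  exists2 f', solution G f' & {in vertices H, f' =1 f}.
Proof.
move=> lG /(moveP lG)[X p q s ->|v w w' lv t ->|v w vw -> ->] sf.
- exists (fun x => if x \in X then f p else f x).
    exact: (surgery_extend lG s sf).
  by move=> x; rewrite !inE => /andP[/negPf->].
- exists (fun x => if x == v then ((f w).1, 0) else f x).
    exact: (trim_extend lG lv t sf).
  by move=> x; rewrite !inE => /andP[/negPf->].
- exists (fun=> f v); last by move=> x; rewrite inE => /eqP->.
  have v0 : (f v).2 = 0.
    by apply: (sol_aloop sf); rewrite /aloop Delta1_aedge !eqxx.
  by split.
Qed.

(** A solution has no freedom of its own at a deleted vertex: its first component is that of a
    survivor, and its flow is either 0 or copied along. This is the source of connectedness on both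
    sides of a move. *)
Lemma move_deleted G H f x : local_graph G -> move G H -> solution G f ->
  x \in vertices G -> exists2 y, y \in vertices H &
    (f x).1 = (f y).1 /\ ((f x).2 = 0 \/ f x = f y).
Proof.
move=> lG /(moveP lG)[X p q s ->|v w w' lv t ->|v w vw -> ->] sf xV /=.
- have [h _ _] := srg_sol s sf; case: (boolP (x \in X)) => xX.
    by exists p; rewrite ?inE ?(srg_p s) ?(srg_pV s) // h //; split; [|right].
  by exists x; rewrite ?inE ?xX //; split; [|right].
- have v0 := sol_aloop sf lv; have [E|xv] := eqVneq x v; last first.
    by exists x; rewrite ?inE ?xv //; split; [|right].
  have [] := sol_tri sf (btriangle_rot t) v0; rewrite E => E1 E2.
  case/btriangleP: t => [[wv vw' ww'] b1 b2 b3].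
  exists w'; last by split; [|left].
  by rewrite !inE eq_sym vw' (b_inr lG b2).
- exists v; first by rewrite inE.
  move: xV; rewrite !inE => /orP[]/eqP->; first by split; [|right].
  have -> : f v = f w; last by split; [|right].
  apply: (sol_iso sf); apply/iso_bP; rewrite Delta3_bedge !eqxx; split=> //.
  by move=> x' y'; rewrite Delta3_bedge => /andP[/eqP-> /eqP->].
Qed.

Lemma move_triangle_back G H x y z : local_graph G -> move G H ->
  btriangle H x y z -> btriangle G x y z.
Proof.
move=> lG /(moveP lG)[X p q s ->|v w w' lv t ->|v w vw -> ->].
- case/btriangleP => ne; rewrite !surgery_bedge.
  case/and3P=> e1 _ _ /and3P[e2 _ _] /and3P[e3 _ _].
  exact/btriangleP.
- case/btriangleP => ne; rewrite !del_bedge.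
  case/and3P=> e1 _ _ /and3P[e2 _ _] /and3P[e3 _ _].
  exact/btriangleP.
- by move=> /Delta1_no_triangle.
Qed.

Definition live f x y z := [/\ (f x).2 != 0, (f y).2 != 0 & (f z).2 != 0].

Lemma move_triangle_live G H f x y z : local_graph G -> move G H ->
  solution G f -> btriangle G x y z -> live f x y z -> btriangle H x y z.
Proof.
move=> lG /(moveP lG)[X p q s ->|v w w' lv t ->|v w vw -> ->] sf tr [x0 y0 z0].
- have xX := srg_tri s tr; have yX := srg_tri s (btriangle_rot tr).
  have zX := srg_tri s (btriangle_rot (btriangle_rot tr)).
  case/btriangleP: tr => ne e1 e2 e3; apply/btriangleP.
  by split=> //; rewrite surgery_bedge ?xX ?yX ?zX ?e1 ?e2 ?e3.
- have v0 := sol_aloop sf lv.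
  have ne u : (f u).2 != 0 -> u != v by apply: contraNneq => ->; rewrite v0.
  by apply: trim_triangle; rewrite ?ne.
- by case: (Delta3_no_triangle tr).
Qed.

(** * Sequences of moves and normal forms *)

Lemma reach_local G H : local_graph G -> total_graph G -> reach G H ->
  local_graph H /\ total_graph H.
Proof.
move=> lG tG r; move: lG tG; elim/connect_step_ind: r => // {}G G1 {}H m _ IH lG tG.
by have [] := move_local lG tG m; exact: IH.
Qed.

Lemma reach_vertices G H : local_graph G -> total_graph G -> reach G H ->
  vertices H \subset vertices G.
Proof.
move=> lG tG r; move: lG tG; elim/connect_step_ind: r => // {}G G1 {}H m _ IH lG tG.
have [l1 t1] := move_local lG tG m.
exact: subset_trans (IH l1 t1) (proper_sub (move_vertices lG m)).
Qed.

Lemma reach_restrict G H f : local_graph G -> total_graph G -> reach G H ->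
  solution G f -> solution H f.
Proof.
move=> lG tG r; move: lG tG; elim/connect_step_ind: r => // {}G G1 {}H m _ IH lG tG.
by have [l1 t1] := move_local lG tG m; move/(move_restrict lG m)/IH; apply.
Qed.

Lemma reach_extend G H f : local_graph G -> total_graph G -> reach G H ->
  solution H f -> exists2 f', solution G f' & {in vertices H, f' =1 f}.
Proof.
move=> lG tG r; move: lG tG; elim/connect_step_ind: r => [{}G _ _ sf|].
  by exists f.
move=> {}G G1 {}H m r IH lG tG sf; have [l1 t1] := move_local lG tG m.
have [f1 s1 E1] := IH l1 t1 sf; have [f2 s2 E2] := move_extend lG m s1.
exists f2 => // x xH; rewrite E2 ?E1 //.
exact: (subsetP (reach_vertices l1 t1 r)).
Qed.

Lemma reach_deleted G H f x : local_graph G -> total_graph G -> reach G H ->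
  solution G f -> x \in vertices G -> exists2 y, y \in vertices H &
    (f x).1 = (f y).1 /\ ((f x).2 = 0 \/ f x = f y).
Proof.
move=> lG tG r; move: lG tG x; elim/connect_step_ind: r => [{}G _ _ x sf xV|].
  by exists x => //; split; [|right].
move=> {}G G1 {}H m r IH lG tG x sf xV; have [l1 t1] := move_local lG tG m.
have [y yV [E o]] := move_deleted lG m sf xV.
have [z zV [E' o']] := IH l1 t1 y (move_restrict lG m sf) yV.
exists z => //; rewrite E E'; split=> //.
case: o => [|->]; first by left.
by case: o'; [left|right].
Qed.

Lemma reach_triangle_back G H x y z : local_graph G -> total_graph G ->
  reach G H -> btriangle H x y z -> btriangle G x y z.
Proof.
move=> lG tG r; move: lG tG; elim/connect_step_ind: r => // {}G G1 {}H m _ IH lG tG.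
by have [l1 t1] := move_local lG tG m; move/IH/(move_triangle_back lG m); apply.
Qed.

Lemma reach_triangle_live G H f x y z : local_graph G -> total_graph G ->
  reach G H -> solution G f -> live f x y z -> btriangle G x y z ->
  btriangle H x y z.
Proof.
move=> lG tG r; move: lG tG; elim/connect_step_ind: r => // {}G G1 {}H m _ IH lG tG.
move=> sf li tr; have [l1 t1] := move_local lG tG m.
apply: IH => //; first exact: (move_restrict lG m sf).
exact: (move_triangle_live lG m sf tr li).
Qed.

Lemma invariant_of_solution G f : local_graph G -> solution G f ->
  {in vertices G, forall x, (f x).2 = 0} -> edge_invariant G (fun x => (f x).1).
Proof.
move=> lG sf f0; split=> x y e; first by rewrite (sol_a sf e).
case: (b_type lG e) => [->//|/(sol_iso sf)->//|[z t]].
by have [] := sol_tri sf t (f0 _ (b_inl lG e)).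
Qed.

Lemma solution_of_invariant G h : edge_invariant G h ->
  solution G (fun x => (h x, 0)).
Proof.
case=> ha hb; split=> //= [x y /ha-> //|x y /iso_bP[_ /hb-> _] //|].
by move=> x y z /btriangleP[_ /hb-> /hb->].
Qed.

(** An edge invariant of [H], paired with the zero flow, extends to a solution of [G]. Its flow
    vanishes everywhere by [reach_deleted], so its first component is an edge invariant of [G],
    hence constant. *)
Lemma reach_reduced G H : reduced G -> reach G H -> reduced H.
Proof.
case=> lG tG cG neG r; have [lH tH] := reach_local lG tG r; split=> //.
  move=> h ih x y xV yV; have [f sf Ef] := reach_extend lG tG r (solution_of_invariant ih).
  have f0 : {in vertices G, forall x, (f x).2 = 0}.
    move=> z zV; have [t tV [_ [//|->]]] := reach_deleted lG tG r sf zV.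
    by rewrite Ef.
  have := cG _ (invariant_of_solution lG sf f0) x y.
  by rewrite !(subsetP (reach_vertices lG tG r)) ?Ef //; apply.
have /set0Pn[x xV] := neG.
(* The zero solution serves only to obtain a survivor from [reach_deleted]. *)
have s0 : solution G (fun=> (0, 0)) by apply: (@solution_of_invariant _ (fun=> 0)).
by have [y yV _] := reach_deleted lG tG r s0 xV; apply/set0Pn; exists y.
Qed.

Lemma conn_closed G (S : {set 'I_N}) v : conn G -> v \in vertices G -> v \in S ->
  (forall x y, aedge G x y || bedge G x y -> (x \in S) = (y \in S)) ->
  vertices G \subset S.
Proof.
move=> cG vV vS cl; apply/subsetP => x xV.
have inv : edge_invariant G (fun x => nat_of_bool (x \in S)).
  by split=> y z e; rewrite (cl y z) ?e ?orbT.
by have := cG _ inv v x vV xV; rewrite vS; case: (x \in S).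
Qed.

(** * Classification of the normal forms *)

Record cubic G : Prop := Cubic {
  cub_a : forall x, ~~ aloop G x;
  cub_b : forall x y, bedge G x y -> exists z, btriangle G x y z }.

(** Unless [lambda3] applies, the a-edge at [v] is a loop too; then [v] is a whole component. *)
Lemma normal_no_bloop G v : reduced G -> ~ nonnormal G -> bloop G v -> G = Delta1 v.
Proof.
case=> lG tG cG neG nn bv; have vV := b_inl lG bv.
have [w e] := total_a tG vV; have [E|vw] := eqVneq v w; last first.
  case: nn; apply/existsP; exists (add_a (del G [set v]) w w).
  apply/or4P; constructor 1; apply/existsP; exists v; apply/existsP; exists w.
  by rewrite bv /iso_a vw e eqxx.
subst w; have VE : vertices G = [set v].
  apply/eqP; rewrite eqEsubset sub1set vV andbT.
  apply: (conn_closed cG vV); rewrite ?inE // => x y.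
  case/orP => e'; rewrite !inE; apply/eqP/eqP => E; subst.
  - exact: (a_fun lG e' e).
  - exact: (a_fun lG (a_sym lG e') e).
  - exact: (b_fun lG e' bv).
  - exact: (b_inj lG e' bv).
apply: eq_qgraph => // x y; rewrite ?Delta1_aedge ?Delta1_bedge.
  apply/idP/andP => [e'|[/eqP-> /eqP-> //]].
  have := a_in lG e'; have := a_in lG (a_sym lG e').
  by rewrite VE !inE.
apply/idP/andP => [e'|[/eqP-> /eqP-> //]].
by have := b_inl lG e'; have := b_inr lG e'; rewrite VE !inE.
Qed.

Lemma pair_vertices G v w : conn G -> local_graph G -> iso_b G v w ->
  (forall x y, aedge G x y -> (x \in [set v; w]) = (y \in [set v; w])) ->
  vertices G = [set v; w] /\
  forall x y, bedge G x y = (x == v) && (y == w).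
Proof.
move=> cG lG i cl; have [vw e h] := iso_bP _ _ _ i; have vV := b_inl lG e.
have VE : vertices G = [set v; w].
  apply/eqP; rewrite eqEsubset subUset !sub1set vV (b_inr lG e) !andbT.
  apply: (conn_closed cG vV); rewrite ?inE ?eqxx // => x y.
  by case/orP; [exact: cl|exact: iso_b_closed].
split=> // x y; apply/idP/andP => [e'|[/eqP-> /eqP->] //].
have [|-> ->] := h _ _ e'; rewrite ?eqxx //.
have := b_inl lG e'; rewrite VE !inE => /orP[]/eqP.
  by constructor 1.
by constructor 2.
Qed.

Lemma Delta2_aedge v w x y :
  aedge (Delta2 v w) x y = (x == v) && (y == w) || (x == w) && (y == v).
Proof. by rewrite /aedge !inE. Qed.

Lemma Delta2_bedge v w x y : bedge (Delta2 v w) x y = (x == v) && (y == w).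
Proof. by rewrite /bedge !inE. Qed.

(** A b-triangle at [v] allows [lambda21], and an isolated b-edge allows [lambda22] unless its other
    end also has an a-loop. In that case the two vertices form the whole graph, which is [Delta3],
    and [exc] applies. *)
Lemma normal_no_aloop G v : reduced G -> ~ nonnormal G ->
  (forall x, ~~ bloop G x) -> ~~ aloop G v.
Proof.
case=> lG tG cG neG nn nb; apply/negP => lv; have vV := a_in lG lv.
have [y [i|[w [w' t]]]] : exists y, (iso_b G v y || iso_b G y v) \/
    exists w w', btriangle G w v w'.
- have [y e] := total_b tG vV; exists y; case: e => e; case: (b_type lG e).
  + by move=> E; subst; case/negP: (nb y).
  + by move=> ->; left.
  + case=> z t; right; exists z, y; exact: (btriangle_rot (btriangle_rot t)).
  + by move=> E; subst; case/negP: (nb v).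
  + by move=> ->; left; rewrite orbT.
  + by case=> z t; right; exists y, z.
- have yv : y != v by case/orP: i => /iso_bP[]; rewrite // eq_sym.
  have yV : y \in vertices G.
    by case/orP: i => /iso_bP[_ e _]; rewrite ?(b_inl lG e) ?(b_inr lG e).
  have [y' e] := total_a tG yV; have [E|yy'] := eqVneq y y'; last first.
    case: nn; apply/existsP; exists (add_a (del G [set v; y]) y' y').
    apply/or4P; constructor 3; apply/existsP; exists v; apply/existsP; exists y.
    apply/existsP; exists y'; rewrite lv i /iso_a yy' e eqxx [y' == y]eq_sym yy' !andbT /=.
    by apply/eqP => E; subst; rewrite (a_fun lG (a_sym lG e) lv) eqxx in yv.
  subst y'; have cl a b : [set a; b] = [set v; y] ->
      forall x z, aedge G x z -> (x \in [set a; b]) = (z \in [set a; b]).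
    move=> -> x z exz.
    suff h a' b' : aedge G a' b' -> a' \in [set v; y] -> b' \in [set v; y].
      by apply/idP/idP; [exact: h|apply: h; exact: (a_sym lG)].
    move=> e'; rewrite !inE => /orP[]/eqP E; subst.
      by rewrite (a_fun lG e' lv) eqxx.
    by rewrite (a_fun lG e' e) eqxx orbT.
  (* [a] and [b] are [v] and [y] in the order of the b-edge, since [exc] keeps its start. *)
  suff D3 a b : a != b -> [set a; b] = [set v; y] -> iso_b G a b -> False.
    by case/orP: i => i; apply: D3 i; rewrite // 1?eq_sym // setUC.
  move=> ab Eab iab; have [VE bE] := pair_vertices cG lG iab (cl _ _ Eab).
  case: nn; apply/existsP; exists (Delta1 a); rewrite /move.
  suff -> : exc G (Delta1 a) by rewrite !orbT.
  apply/existsP; exists a; apply/existsP; exists b; rewrite ab eqxx andbT /=.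
  apply/eqP/eq_qgraph => // p q; rewrite ?Delta3_aedge ?Delta3_bedge //.
  have L x : x \in [set a; b] -> aedge G x x.
    by rewrite Eab !inE => /orP[]/eqP->.
  apply/idP/andP => [e'|[/eqP<-]]; last exact: L.
  have pV := a_in lG e'; rewrite VE in pV; split=> //.
  by apply/eqP; apply: (a_fun lG (L p pV)).
case: nn; apply/existsP; exists (del G [set v]); apply/or4P; constructor 2.
apply/existsP; exists v; apply/existsP; exists w; apply/existsP; exists w'.
by rewrite lv t eqxx.
Qed.

(** If the a-edge at [v] ends at [w], the pair is a whole component; otherwise both a-edges leave
    the pair and [kappa3] applies. *)
Lemma normal_iso_b G v w : reduced G -> ~ nonnormal G ->
  (forall x, ~~ aloop G x) -> iso_b G v w -> G = Delta2 v w.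
Proof.
case=> lG tG cG neG nn na i; have [vw e h] := iso_bP _ _ _ i.
have [v' ev] := total_a tG (b_inl lG e).
have [w' ew] := total_a tG (b_inr lG e).
have vv' : v != v' by apply/eqP => E; subst; case/negP: (na v').
have ww' : w != w' by apply/eqP => E; subst; case/negP: (na w').
have [E|wv'] := eqVneq w v'.
  subst v'; have cl x y : aedge G x y -> (x \in [set v; w]) = (y \in [set v; w]).
    move=> exy.
    suff H a' b' : aedge G a' b' -> a' \in [set v; w] -> b' \in [set v; w].
      by apply/idP/idP; [exact: H|apply: H; exact: (a_sym lG)].
    move=> e'; rewrite !inE => /orP[]/eqP E; subst.
      by rewrite (a_fun lG e' ev) eqxx orbT.
    by rewrite (a_fun lG e' (a_sym lG ev)) eqxx.
  have [VE bE] := pair_vertices cG lG i cl.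
  apply: eq_qgraph => // x y; rewrite ?Delta2_aedge ?Delta2_bedge //.
  apply/idP/orP => [e'|[]/andP[/eqP-> /eqP->] //]; last exact: (a_sym lG).
  have := a_in lG e'; rewrite VE !inE => /orP[]/eqP E; subst x.
    by left; rewrite (a_fun lG e' ev) !eqxx.
  by right; rewrite (a_fun lG e' (a_sym lG ev)) !eqxx.
case: nn; apply/existsP; exists (add_a (del G [set v; w]) v' w').
apply/or4P; constructor 4; apply/orP; left.
apply/existsP; exists v; apply/existsP; exists w; apply/existsP; exists v'; apply/existsP; exists w'.
rewrite i /iso_a vv' ww' ev ew eqxx /= !inE !negb_or vw vv' wv' ww' /= !andbT.
apply/andP; split; apply/eqP => E; subst.
  by rewrite (a_fun lG (a_sym lG ew) ev) eqxx in wv'.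
by rewrite (a_fun lG (a_sym lG ew) (a_sym lG ev)) eqxx in vw.
Qed.

Lemma normal_cases G : reduced G -> ~ nonnormal G ->
  [\/ is_Delta1 G, is_Delta2 G | cubic G].
Proof.
move=> rG nn; have lG := red_local rG.
case: (boolP [exists v, bloop G v]) => [/existsP[v bv]|/existsPn nb].
  constructor 1; apply/existsP; exists v; apply/eqP; exact: normal_no_bloop.
have na x : ~~ aloop G x by apply: normal_no_aloop.
case: (boolP [exists v, exists w, iso_b G v w]).
  case/existsP=> v /existsP[w i]; constructor 2.
  apply/existsP; exists v; apply/existsP; exists w.
  rewrite (normal_iso_b rG nn na i) eqxx andbT; by case/iso_bP: i.
move=> ni; constructor 3; split=> // x y e.
case: (b_type lG e) => [E|i|//]; first by subst; case/negP: (nb y).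
by case/negP: ni; apply/existsP; exists x; apply/existsP; exists y.
Qed.

Lemma Delta1_card v : #|vertices (Delta1 v)| = 1.
Proof. exact: cards1. Qed.

Lemma Delta2_card v w : v != w -> #|vertices (Delta2 v w)| = 2.
Proof. by move=> vw; rewrite cards2 vw. Qed.

Lemma cubic_card G : reduced G -> cubic G -> 2 < #|vertices G|.
Proof.
case=> lG tG _ /set0Pn[x xV] [_ cb]; have [y e] := total_b tG xV.
have [x' [y' [z t]]] : exists x y z, btriangle G x y z.
  by case: e => /cb[z t]; [exists x, y, z|exists y, x, z].
case/and4P: t => u e1 e2 e3; rewrite cardE.
apply: (@uniq_leq_size _ [:: x'; y'; z]) => // t.
by rewrite mem_enum !inE => /or3P[]/eqP->;
  [exact: (b_inl lG e1)|exact: (b_inl lG e2)|exact: (b_inl lG e3)].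
Qed.

Lemma Delta2_no_triangle v w x y z : ~ btriangle (Delta2 v w) x y z.
Proof.
case/btriangleP=> [[xy _ _]]; rewrite !Delta2_bedge.
by case/andP=> /eqP E /eqP E' /andP[/eqP E'' _]; rewrite E E'' eqxx in xy.
Qed.

Lemma normal_cubic G x y z : reduced G -> ~ nonnormal G ->
  btriangle G x y z -> cubic G.
Proof.
move=> rG nn t; case: (normal_cases rG nn) => //.
  by case/existsP => v /eqP E; case: (@Delta1_no_triangle v x y z); rewrite -E.
case/existsP => v /existsP[w /andP[_ /eqP E]].
by case: (@Delta2_no_triangle v w x y z); rewrite -E.
Qed.

(** * Moves compatible with the label conventions *)

Lemma conv_move_looped_triangle G : reduced G -> looped_triangle G ->
  exists H, conv_move G H.
Proof.
case=> lG tG _ /set0Pn[x0 x0V] /forallP lt.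
have [x1 e1] : exists x, [exists y, bedge G x y].
  have [y [e|e]] := total_b tG x0V; [exists x0|exists y]; apply/existsP;
  by [exists y|exists x0].
case: (@arg_maxnP _ _ (fun x => [exists y, bedge G x y]) val e1) =>
  x /existsP[y e] mx.
have := lt x; rewrite (b_inl lG e) => /andP[_ /existsP[y' /existsP[z t]]].
have yy' : y' = y by case/btriangleP: t => _ e' _ _; exact: (b_fun lG e' e).
subst y'; case/btriangleP: (t) => [[xy yz xz] b1 b2 b3].
have lz : aloop G z by have := lt z; rewrite (b_inl lG b3) => /andP[].
(* [z] is the vertex of the triangle off the b-edge [x -> y] of maximal start, which therefore
   survives. *)
exists (del G [set z]); apply/andP; split.
  apply/or4P; constructor 2; apply/existsP; exists z.
  apply/existsP; exists y; apply/existsP; exists x.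
  by rewrite lz (btriangle_rot t) eqxx.
apply/implyP => _; apply/existsP; exists x; apply/existsP; exists y.
apply/and3P; split=> //; last by rewrite del_bedge e !inE xz yz.
apply/forallP => u; apply/forallP => w; apply/implyP => euw; apply: mx.
by apply/existsP; exists w.
Qed.

(** On such a cycle every move is a [kappa3]. If the one at hand would delete the b-edge of maximal
    start, the neighbouring b-edge can be deleted instead. *)
Lemma conv_move_alternating_cycle G : reduced G -> nonnormal G ->
  alternating_cycle G -> exists H, conv_move G H.
Proof.
case=> lG tG _ _ /existsP[H0 m] /forallP ac.
have na x : ~~ aloop G x.
  apply/negP => l; have := ac x; rewrite (a_in lG l) => /andP[/existsP[y]].
  by case/iso_aP=> xy /(a_fun lG l) E; rewrite E eqxx in xy.
have nb x : x \in vertices G -> exists y, iso_b G x y || iso_b G y x.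
  by move=> xV; have := ac x; rewrite xV => /andP[_ /existsP].
have kappa v w v' w' : iso_b G v w -> iso_a G v v' -> iso_a G w w' ->
    uniq [:: v; w; v'; w'] -> forall x y, bedge G x y ->
    (forall u t, bedge G u t -> u <= x) ->
    x \notin [set v; w] -> y \notin [set v; w] -> exists H, conv_move G H.
  move=> i ev ew u x y e mx xn yn; exists (add_a (del G [set v; w]) v' w').
  apply/andP; split.
    apply/or4P; constructor 4; apply/orP; left; apply/existsP; exists v.
    apply/existsP; exists w; apply/existsP; exists v'; apply/existsP; exists w'.
    by rewrite i ev ew u eqxx.
  apply/implyP => _; apply/existsP; exists x; apply/existsP; exists y.
  apply/and3P; split=> //; last by rewrite surgery_bedge e xn yn.
  by apply/forallP => u'; apply/forallP => t; apply/implyP; exact: mx.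
have [v [w [v' [w' [i ev ew u]]]]] : exists v w v' w',
    [/\ iso_b G v w, iso_a G v v', iso_a G w w' & uniq [:: v; w; v'; w']].
  case/or4P: m => [|||/orP[|]].
  - case/existsP=> v /existsP[w /and3P[bv _ _]].
    have [y /orP[]i] := nb v (b_inl lG bv); have := iso_b_no_bloop (x := v) i;
    by rewrite !inE eqxx ?orbT bv => /(_ isT).
  - by case/existsP=> v /existsP[w /existsP[w' /and3P[]]]; rewrite (negPf (na v)).
  - case/existsP=> v /existsP[w /existsP[w' /and5P[]]].
    by rewrite (negPf (na v)).
  - case/existsP=> v /existsP[w /existsP[v' /existsP[w' /and5P[]]]].
    by exists v, w, v', w'.
  - case/existsP=> v /existsP[w /and3P[_ /eqP E _]].
    by have := na v; rewrite /aloop E Delta3_aedge !inE eqxx.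
have [vw bvw hvw] := iso_bP _ _ _ i.
have e1 : [exists y, bedge G v y] by apply/existsP; exists w.
case: (@arg_maxnP _ _ (fun x => [exists y, bedge G x y]) val e1) =>
  x /existsP[y e] mx.
have {}mx u' t : bedge G u' t -> u' <= x.
  by move=> e'; apply: mx; apply/existsP; exists t.
case: (boolP (x \in [set v; w])) => xn; last first.
  by apply: (kappa _ _ _ _ i ev ew u x y) => //; rewrite -(iso_b_closed i e).
have [xE yE] : x = v /\ y = w.
  by apply: hvw => //; move: xn; rewrite !inE => /orP[]/eqP; [constructor 1|constructor 2].
subst x y.
move: u; rewrite /= !inE !negb_or !andbT => /and3P[/and3P[_ vv' vw'] /andP[wv' ww'] v'w'].
case/iso_aP: ev => _ ev; case/iso_aP: ew => _ ew.
(* The maximal b-edge is now [v -> w] itself. The b-edge deleted instead joins [v'], the a-neighbour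
   of [v], to [u], in either orientation. The a-neighbour [u'] of [u] may well be [w]; the result is
   then [Delta2]. *)
have [u iu] := nb v' (a_in lG (a_sym lG ev)).
have un : u \notin [set v; w] /\ u != v'.
  split; last by case/orP: iu => /iso_bP[]; rewrite // eq_sym.
  have vn : v' \notin [set v; w] by rewrite !inE negb_or eq_sym vv' eq_sym.
  by case/orP: iu => /iso_bP[_ e' _]; [rewrite -(iso_b_closed i e')|
    rewrite (iso_b_closed i e')].
have {un}[un uv'] := un; move: (un); rewrite !inE negb_or => /andP[uv uw].
have uV : u \in vertices G.
  by case/orP: iu => /iso_bP[_ e' _]; rewrite ?(b_inl lG e') ?(b_inr lG e').
have [u' eu] := total_a tG uV.
have uu' : u != u' by apply/eqP => E; subst; case/negP: (na u').
have u'v : u' != v.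
  by apply/eqP => E; subst; rewrite (a_fun lG (a_sym lG eu) ev) eqxx in uv'.
have u'v' : u' != v'.
  apply/eqP => E; subst.
  by rewrite (a_fun lG (a_sym lG eu) (a_sym lG ev)) eqxx in uv.
have ia : iso_a G v' v by rewrite /iso_a eq_sym vv' (a_sym lG ev).
have ia' : iso_a G u u' by rewrite /iso_a uu' eu.
case/orP: iu => iu.
  apply: (kappa _ _ _ _ iu ia ia' _ v w) => //; rewrite /= !inE !negb_or.
  - by rewrite ![v' == _]eq_sym uv' vv' u'v' uv uu' eq_sym u'v.
  - by rewrite vv' eq_sym.
  - by rewrite wv' eq_sym.
apply: (kappa _ _ _ _ iu ia' ia _ v w) => //; rewrite /= !inE !negb_or.
- by rewrite ![v' == _]eq_sym uv' vv' u'v' uv uu' u'v.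
- by rewrite vv' eq_sym uv.
- by rewrite wv' eq_sym uw.
Qed.

Lemma qsilhP G : reduced G ->
  [/\ reach G (qsilh G), reduced (qsilh G) & ~ nonnormal (qsilh G)].
Proof.
move=> rG; rewrite /qsilh; case: pickP => [H /andP[c nn]|none] /=.
  have r : reach G H.
    apply: connect_sub c => x y /andP[m _]; exact: connect1.
  by split=> //; [exact: reach_reduced r|exact/negP].
suff [H [c nn]] : exists H, connect (@conv_move N) G H /\ ~~ nonnormal H.
  by have := none H; rewrite /is_qsilh c nn.
move: rG {none}; have [k] := ubnP #|vertices G|; elim: k G => // k IH G lk rG.
have [nn|nn] := boolP (nonnormal G); last by exists G.
have [H mH] : exists H, conv_move G H.
  case lt: (looped_triangle G); first exact: conv_move_looped_triangle.
  case ac: (alternating_cycle G); first exact: conv_move_alternating_cycle.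
  by case/existsP: nn => H m; exists H; rewrite /conv_move m lt ac.
have [m _] := andP mH.
have [||H' [c n']] := IH H.
- exact: leq_trans (proper_card (move_vertices (red_local rG) m)) _.
- exact: reach_reduced rG (connect1 m).
- by exists H'; split=> //; exact: connect_trans (connect1 mH) c.
Qed.

(** * Replacing the surviving part of a graph *)

Definition b_closed G (K : {set 'I_N}) :=
  forall x y, bedge G x y -> (x \in K) = (y \in K).

Definition b_agree_off G1 G2 (K : {set 'I_N}) :=
  forall x y, x \notin K -> bedge G1 x y = bedge G2 x y.

Lemma iso_b_off G1 G2 K x y : b_closed G1 K -> b_closed G2 K ->
  b_agree_off G1 G2 K -> x \notin K -> iso_b G1 x y -> iso_b G2 x y.
Proof.
move=> c1 c2 ag xK /iso_bP[xy e h]; apply/iso_bP; rewrite -ag //.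
split=> // u w e' t; apply: (h u w _ t); rewrite ag //.
have yK : y \notin K by rewrite -(c1 _ _ e).
by case: t => [->|->|E|E] //; rewrite (c2 _ _ e') E.
Qed.

Lemma btriangle_off G1 G2 K x y z : b_closed G1 K ->
  b_agree_off G1 G2 K -> x \notin K -> btriangle G1 x y z -> btriangle G2 x y z.
Proof.
move=> c1 ag xK /btriangleP[ne e1 e2 e3]; apply/btriangleP.
have yK : y \notin K by rewrite -(c1 _ _ e1).
have zK : z \notin K by rewrite -(c1 _ _ e2).
by rewrite -!ag.
Qed.

Lemma cubic_triangle H x : reduced H -> cubic H -> x \in vertices H ->
  exists y z, btriangle H x y z.
Proof.
case=> lH tH _ _ [_ cb] xV; have [y [e|e]] := total_b tH xV.
  by have [z t] := cb _ _ e; exists y, z.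
have [z t] := cb _ _ e; exists z, y; exact: btriangle_rot.
Qed.

(** Where the flow is nonzero the triangles impose nothing, so only the a-edges constrain it. *)
Lemma cubic_solution H f : cubic H -> (forall x, (f x).2 != 0) ->
  (forall x y, aedge H x y -> f x = f y) -> solution H f.
Proof.
move=> [ca cb] f0 fa; split=> [//|x l|x l|x y i|x y z _ E].
- by case/negP: (ca x).
- by have [z /btriangleP[[]]] := cb _ _ l; rewrite eqxx.
- have [_ e _] := iso_bP _ _ _ i; have [z t] := cb _ _ e.
  by case: (iso_b_not_triangle i t).
- by move: (f0 x); rewrite E.
Qed.

(** [H] is the new surviving part. Pulling the a-edges of [G] back along [tau] permutes the ends at
    surviving vertices and keeps the deleted vertices between them in place. *)
Definition transfer G H (tau : 'I_N -> 'I_N) : qgraph N :=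
  QGraph (vertices G)
    [set e | aedge G (tau e.1) (tau e.2)]
    [set e | bedge G e.1 e.2 && (e.1 \notin vertices H) || bedge H e.1 e.2].

Section Transfer.
Variables (G H H' : qgraph N) (tau sigma : 'I_N -> 'I_N).
Hypotheses (rG : reduced G) (GH : reach G H) (cH : cubic H).
Hypotheses (rH' : reduced H') (cH' : cubic H').
Hypothesis (VH' : vertices H' = vertices H).
Hypotheses (tauK : cancel tau sigma) (sigmaK : cancel sigma tau).
Hypothesis tau_out : forall x, x \notin vertices H -> tau x = x.
Hypothesis tau_a : forall x y, aedge H' x y = aedge H (tau x) (tau y).

Let K := vertices H.
Let T := transfer G H' tau.
Let lG := red_local rG.
Let tG := red_total rG.
Let rH : reduced H := reach_reduced rG GH.
Let lH := red_local rH.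
Let tH := red_total rH.
Let lH' := red_local rH'.
Let tH' := red_total rH'.

Lemma core_sub : K \subset vertices G.
Proof. exact: reach_vertices lG tG GH. Qed.

(** Every survivor lies on a b-triangle of [H], which is a triangle of [G] as well and leaves no
    room for another b-edge. *)
Lemma core_b x y : x \in K -> bedge G x y = bedge H x y.
Proof.
move=> xK; have [p [q t]] := cubic_triangle rH cH xK.
have := reach_triangle_back lG tG GH t.
case/btriangleP=> _ e1 _ _; case/btriangleP: t => _ e2 _ _.
apply/idP/idP => e; first by rewrite (b_fun lG e e1).
by rewrite (b_fun lH e e2).
Qed.

Lemma core_b_closed : b_closed G K.
Proof.
move=> x y e; apply/idP/idP => [xK|yK].
  by rewrite (core_b y xK) in e; exact: (b_inr lH e).
have [p [q t]] := cubic_triangle rH cH yK.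
have := reach_triangle_back lG tG GH t.
case/btriangleP=> _ _ _ e1; case/btriangleP: t => _ _ _ e2.
by rewrite (b_inj lG e e1); exact: (b_inl lH e2).
Qed.

Lemma tau_in x : (tau x \in K) = (x \in K).
Proof.
apply/idP/idP => xK; apply: contraTT xK => xK; first by rewrite tau_out.
by rewrite -(can_inj tauK (tau_out xK)).
Qed.

Lemma sigma_out x : x \notin K -> sigma x = x.
Proof. by move=> xK; rewrite -{1}(tau_out xK) tauK. Qed.

Lemma sigma_in x : (sigma x \in K) = (x \in K).
Proof. by rewrite -{2}(sigmaK x) tau_in. Qed.

Lemma transfer_aedge x y : aedge T x y = aedge G (tau x) (tau y).
Proof. by rewrite /aedge inE. Qed.

Lemma transfer_b_in x y : x \in K -> bedge T x y = bedge H' x y.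
Proof. by move=> xK; rewrite /bedge inE /= VH' xK andbF. Qed.

Lemma transfer_b_out : b_agree_off T G K.
Proof.
move=> x y xK; rewrite {1}/bedge inE /= VH' xK andbT orbC.
case: (boolP (bedge H' x y)) => // /(b_inl lH').
by rewrite VH' => xK'; rewrite xK' in xK.
Qed.

Lemma transfer_b_closed : b_closed T K.
Proof.
move=> x y; case: (boolP (x \in K)) => xK.
  by rewrite transfer_b_in // => /(b_inr lH'); rewrite VH'.
by rewrite transfer_b_out // => /core_b_closed; rewrite (negPf xK).
Qed.

Lemma out_agree : b_agree_off G T K.
Proof. by move=> x y xK; rewrite transfer_b_out. Qed.

Lemma transfer_triangle_in x : x \in K -> exists y z,
  [/\ btriangle T x y z, y \in K & z \in K].
Proof.
rewrite -[K]VH' => xK; have [y [z t]] := cubic_triangle rH' cH' xK.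
case/btriangleP: (t) => ne e1 e2 e3.
have yK := b_inr lH' e1; have zK := b_inr lH' e2; exists y, z; split=> //.
by apply/btriangleP; rewrite !transfer_b_in // -[K]VH'.
Qed.

Lemma transfer_V x : (tau x \in vertices G) = (x \in vertices G).
Proof.
case: (boolP (x \in K)) => xK; last by rewrite tau_out.
by rewrite !(subsetP core_sub) ?tau_in.
Qed.

Lemma transfer_local : local_graph T.
Proof.
split=> [x y|x y|x y z|x y|x y|x y z|x y z|x y]; rewrite ?transfer_aedge.
- by move/(a_in lG); rewrite transfer_V.
- exact: (a_sym lG).
- by move=> e e'; apply: (can_inj tauK); exact: (a_fun lG e e').
- case: (boolP (x \in K)) => [/(subsetP core_sub) //|xK].
  by rewrite transfer_b_out //; exact: (b_inl lG).
- case: (boolP (y \in K)) => [/(subsetP core_sub) //|yK] e.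
  have xK : x \notin K by rewrite (transfer_b_closed e).
  by rewrite transfer_b_out // in e; exact: (b_inr lG e).
- case: (boolP (x \in K)) => xK.
    by rewrite !transfer_b_in //; exact: (b_fun lH').
  by rewrite !transfer_b_out //; exact: (b_fun lG).
- move=> e e'; have := transfer_b_closed e; rewrite -(transfer_b_closed e') => E.
  move: e e'; case: (boolP (x \in K)) => xK.
    by rewrite !transfer_b_in // -?E //; exact: (b_inj lH').
  by rewrite !transfer_b_out // -?E //; exact: (b_inj lG).
- move=> e; case: (boolP (x \in K)) => xK.
    have [p [q [t _ _]]] := transfer_triangle_in xK.
    constructor 3; exists q; case/btriangleP: (t) => _ e' _ _; move: e e' t.
    by rewrite !transfer_b_in // => e e'; rewrite (b_fun lH' e e').
  rewrite transfer_b_out // in e; case: (b_type lG e) => [->|i|[z t]].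
  + by constructor 1.
  + constructor 2.
    exact: (iso_b_off core_b_closed transfer_b_closed out_agree xK i).
  + constructor 3; exists z.
    exact: (btriangle_off core_b_closed out_agree xK t).
Qed.

Lemma transfer_total : total_graph T.
Proof.
split=> x xV; rewrite /T /= in xV.
  rewrite -transfer_V in xV; have [y e] := total_a tG xV.
  by exists (sigma y); rewrite transfer_aedge sigmaK.
case: (boolP (x \in K)) => xK.
  have [y [z [/btriangleP[_ e _ _] _ _]]] := transfer_triangle_in xK.
  by exists y; left.
have [y e] := total_b tG xV; exists y.
have yK : y \notin K by case: e => /core_b_closed E; rewrite ?E // -E.
by rewrite !transfer_b_out.
Qed.

Lemma core_flow_extend f : (forall x, (f x).2 != 0) ->
  (forall x y, aedge H x y -> f x = f y) ->
  exists2 g, solution G g & {in K, g =1 f}.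
Proof. by move=> f0 fa; apply: (reach_extend lG tG GH); apply: cubic_solution. Qed.

(** A nonzero flow does not notice how [K] is divided into triangles, and off [K] both the b-edges
    and [tau] are as before. *)
Lemma transfer_solution f : solution G f -> {in K, forall x, (f x).2 != 0} ->
  solution T (fun x => f (tau x)).
Proof.
move=> sf f0; split=> [x y|x|x l|x y i|x y z t].
- by rewrite transfer_aedge => /(sol_a sf).
- by rewrite /aloop transfer_aedge => /(sol_aloop sf).
- case: (boolP (x \in K)) => xK.
    have [y [z [/btriangleP[[xy _ _] e _ _] _ _]]] := transfer_triangle_in xK.
    by rewrite (b_fun transfer_local l e) eqxx in xy.
  rewrite tau_out //; apply: (sol_bloop sf).
  by rewrite /bloop -transfer_b_out.
- case/iso_bP: (i) => _ e _; case: (boolP (x \in K)) => xK.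
    have [p [q [t _ _]]] := transfer_triangle_in xK.
    case/btriangleP: (t) => _ e' _ _; rewrite -(b_fun transfer_local e e') in t.
    by case: (iso_b_not_triangle i t).
  have yK : y \notin K by rewrite -(transfer_b_closed e).
  rewrite !tau_out //; apply: (sol_iso sf).
  exact: (iso_b_off transfer_b_closed core_b_closed transfer_b_out xK i).
- case: (boolP (x \in K)) => xK.
    by move=> E; have := f0 (tau x); rewrite tau_in E => /(_ xK).
  case/btriangleP: (t) => _ e1 e2 _.
  have yK : y \notin K by rewrite -(transfer_b_closed e1).
  have zK : z \notin K by rewrite -(transfer_b_closed e2).
  rewrite !tau_out //; apply: (sol_tri sf).
  exact: (btriangle_off transfer_b_closed transfer_b_out xK t).
Qed.

(** Being constant on [K], [f] is unchanged by [sigma], so it satisfies the conditions on the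
    a-edges of both graphs. *)
Lemma untransfer_solution f : solution T f -> {in K, forall x, f x = (0, 1)} ->
  solution G f.
Proof.
move=> sf f1; have ft x : f (sigma x) = f x.
  case: (boolP (x \in K)) => xK; last by rewrite sigma_out.
  by rewrite !f1 // sigma_in.
split=> [x y e|x l|x l|x y i|x y z t].
- by rewrite -ft -(ft y); apply: (sol_a sf); rewrite transfer_aedge !sigmaK.
- by rewrite -ft; apply: (sol_aloop sf); rewrite /aloop transfer_aedge sigmaK.
- apply: (sol_bloop sf); rewrite /bloop transfer_b_out //; apply/negP => xK.
  rewrite /bloop core_b // in l.
  by have [z /btriangleP[[]]] := cub_b cH l; rewrite eqxx.
- case/iso_bP: (i) => _ e _; have [xK|xK] := boolP (x \in K).
    by have yK := xK; rewrite (core_b_closed e) in yK; rewrite !f1 //.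
  apply: (sol_iso sf).
  exact: (iso_b_off core_b_closed transfer_b_closed out_agree xK i).
- have [xK|xK] := boolP (x \in K); first by rewrite f1.
  by apply: (sol_tri sf); exact: (btriangle_off core_b_closed out_agree xK t).
Qed.

(** An edge invariant [h] of [T] need not respect the old triangles on [K], but pairing it with a
    flow equal to 1 on [K] lifts the constraints there. The pair is thus a solution of [G];
    restricted to [H], it shows that [h] is an edge invariant of [H'], hence constant on [K]. By
    [reach_deleted], [h] takes no other value. *)
Lemma transfer_conn : conn T.
Proof.
move=> h [ha hb].
have [g sg gK] := @core_flow_extend (fun=> (0, 1)) (fun=> isT) (fun _ _ _ => erefl).
(* The a-edges of [G] are those of [T] moved by [tau], hence the composition with [sigma]. *)
pose f x := (h (sigma x), (g x).2).
have sf : solution G f.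
  split=> [x y e|x l|x l|x y i|x y z t].
  - rewrite /f (sol_a sg e); congr pair; apply: ha.
    by rewrite transfer_aedge !sigmaK.
  - exact: (sol_aloop sg).
  - exact: (sol_bloop sg).
  - case/iso_bP: (i) => _ e _; have xK : x \notin K.
      apply/negP => xK; rewrite core_b // in e; have [z t] := cub_b cH e.
      by apply: (iso_b_not_triangle i); exact: (reach_triangle_back lG tG GH t).
    have yK : y \notin K by rewrite -(core_b_closed e).
    rewrite /f (sol_iso sg i) !sigma_out // (hb x y) //.
    by rewrite transfer_b_out.
  - rewrite /= => x0; have xK : x \notin K.
      by apply/negP => xK; rewrite gK in x0.
    case/btriangleP: (t) => _ e1 e2 _.
    have yK : y \notin K by rewrite -(core_b_closed e1).
    have zK : z \notin K by rewrite -(core_b_closed e2).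
    have [E _] := sol_tri sg t x0.
    rewrite /f /= E !sigma_out // (hb x y) ?(hb y z) //; by rewrite transfer_b_out.
have sH := reach_restrict lG tG GH sf.
have inv : edge_invariant H' h.
  split=> x y e; last by apply: hb; rewrite transfer_b_in // -[K]VH' (b_inl lH' e).
  by move: e; rewrite tau_a => /(sol_a sH)[]; rewrite !tauK.
have hK := red_conn rH' inv.
have all x : x \in vertices G -> exists2 y, y \in K & h x = h y.
  rewrite -transfer_V => xV; have [y yK [E _]] := reach_deleted lG tG GH sf xV.
  by exists (sigma y); [rewrite sigma_in|move: E; rewrite /= tauK].
move=> x y /all[x' xK ->] /all[y' yK ->]; by apply: hK; rewrite VH'.
Qed.

Lemma transfer_reduced : reduced T.
Proof.
split; [exact: transfer_local|exact: transfer_total|exact: transfer_conn|].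
exact: (red_ne rG).
Qed.

(** [L] is an arbitrary normal form of [T], so the choice made by [qsilh] is irrelevant. Flows equal
    to 1 on the survivors determine its vertices, and flows with values 1 and 2 determine its
    a-edges. *)
Lemma transfer_normal_form L : reach T L -> ~ nonnormal L -> L = H'.
Proof.
move=> TL nn; have lT := transfer_local; have tT := transfer_total.
have rL := reach_reduced transfer_reduced TL; have lL := red_local rL.
have flow1 := core_flow_extend (f := fun=> (0, 1)) (fun=> isT) (fun _ _ _ => erefl).
(* The flow 1 on [H] extends to [G], transfers to [T], and keeps the new triangles alive. *)
have tri x y z : x \in K -> btriangle T x y z -> btriangle L x y z.
  move=> xK t; have [g sg gK] := flow1.
  have gnz : {in K, forall x, (g x).2 != 0} by move=> u uK; rewrite gK.
  case/btriangleP: (t) => _ e1 e2 _.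
  have yK : y \in K by rewrite -(transfer_b_closed e1).
  have zK : z \in K by rewrite -(transfer_b_closed e2).
  apply: (reach_triangle_live lT tT TL (transfer_solution sg gnz) _ t).
  by split; apply: gnz; rewrite tau_in.
have cL : cubic L.
  have /set0Pn[x] := red_ne rH; rewrite -/K => xK.
  have [y [z [t _ _]]] := transfer_triangle_in xK.
  exact: (normal_cubic rL nn (tri _ _ _ xK t)).
have KL : K \subset vertices L.
  apply/subsetP => x xK; have [y [z [t _ _]]] := transfer_triangle_in xK.
  by case/btriangleP: (tri _ _ _ xK t) => _ e _ _; exact: (b_inl lL e).
have VL : vertices L = K.
  apply/eqP; rewrite eqEsubset KL andbT; apply/subsetP => x xL.
  apply: contraT => xK; have [y [z t]] := cubic_triangle rL cL xL.
  (* A triangle of [L] off [K] is also a triangle of [G]. The flow 1 on [L], extended to [T] and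
     carried back to [G], is live on it, so it would survive in [H], whose vertex set is [K]. *)
  have sL : solution L (fun=> (0, 1)) by apply: cubic_solution.
  have [g sg gL] := reach_extend lT tT TL sL.
  have gK : {in K, forall x, g x = (0, 1)}.
    by move=> u uK; rewrite gL // (subsetP KL).
  have tT' := reach_triangle_back lT tT TL t.
  have tG' := btriangle_off transfer_b_closed transfer_b_out xK tT'.
  have sG := untransfer_solution sg gK.
  have li : live g x y z.
    by case/btriangleP: t => _ e1 e2 _; split;
      rewrite gL // ?(b_inr lL e1) ?(b_inr lL e2).
  have := reach_triangle_live lG tG GH sG li tG'.
  by case/btriangleP => _ e _ _; case/negP: xK; exact: (b_inl lH e).
have aL x y : aedge L x y -> aedge H (tau x) (tau y).
  move=> e; have xK : tau x \in K by rewrite tau_in -VL (a_in lL e).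
  have [p ep] := total_a tH xK.
  (* Both values are nonzero, so that the triangles impose nothing; they differ, so that the flow
     singles out the a-edge of [H] at [tau x]. *)
  pose f u := if (u == tau x) || (u == p) then (0, 2) else (0, 1).
  have [g sg gK] : exists2 g, solution G g & {in K, g =1 f}.
    apply: core_flow_extend => [u|u w e']; first by rewrite /f; case: ifP.
    suff h u' w' : aedge H u' w' -> (u' == tau x) || (u' == p) ->
        (w' == tau x) || (w' == p).
      by congr (if _ then _ else _); apply/idP/idP; apply: h => //; exact: (a_sym lH).
    move=> e'' /orP[]/eqP E; subst u'.
      by rewrite (a_fun lH e'' ep) eqxx orbT.
    by rewrite (a_fun lH e'' (a_sym lH ep)) eqxx.
  have gnz : {in K, forall x, (g x).2 != 0}.
    by move=> u uK; rewrite gK // /f; case: ifP.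
  have := sol_a (reach_restrict lT tT TL (transfer_solution sg gnz)) e.
  have yK : tau y \in K by rewrite tau_in -VL (a_in lL (a_sym lL e)).
  rewrite !gK // {1}/f eqxx /= /f; case: ifP => // /orP[]/eqP E _; last by rewrite E.
  (* The flow 2 leaves [tau y] equal to [tau x] or [p]; the first would turn the edge into an a-loop
     of [L]. *)
  case/negP: (cub_a cL x); rewrite /aloop -{2}(can_inj tauK E) //.
apply: eq_qgraph; first by rewrite VL VH'.
- move=> x y; rewrite tau_a; apply/idP/idP; first exact: aL.
  move=> e; have xL : x \in vertices L by rewrite VL -tau_in (a_in lH e).
  have [p ep] := total_a (red_total rL) xL.
  by rewrite -(can_inj tauK (a_fun lH (aL _ _ ep) e)).
- move=> x y; apply/idP/idP => e.
    have [z t] := cub_b cL e.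
    have /btriangleP[_ e' _ _] := reach_triangle_back lT tT TL t.
    by rewrite -transfer_b_in // -VL (b_inl lL e).
  have xK : x \in K by rewrite -[K]VH' (b_inl lH' e).
  have [p [q [t _ _]]] := transfer_triangle_in xK.
  case/btriangleP: (tri _ _ _ xK t) => _ e1 _ _.
  case/btriangleP: t => _; rewrite transfer_b_in // => e2 _ _.
  by rewrite (b_fun lH' e e2).
Qed.

End Transfer.

End Moves.

(** * Labelings *)

Section Involutions.
Variable s : nat.
Implicit Types (m : 'I_s -> 'I_s) (x y : 'I_s).

Definition lower m : {set 'I_s} := [set x : 'I_s | x < m x].

Lemma lower_flip m x : involutive m -> (forall x, m x != x) ->
  (m x \in lower m) = (x \notin lower m).
Proof.
by move=> mK mn; rewrite !inE mK -leqNgt ltn_neqAle (inj_eq val_inj) mn.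
Qed.

Lemma card_lower m : involutive m -> (forall x, m x != x) ->
  #|lower m|.*2 = s.
Proof.
move=> mK mn; rewrite -addnn -[RHS]card_ord -(cardsC (lower m)); congr addn.
rewrite -(card_imset (mem (lower m)) (inv_inj mK)); apply: eq_card => x.
apply/imsetP/idP => [[y yR ->]|]; first by rewrite in_setC lower_flip ?negbK.
by rewrite in_setC => xR; exists (m x); rewrite ?mK ?lower_flip.
Qed.

(** [lower] picks one point in each pair, and both choices have [s / 2] elements. Any bijection
    between them extends to the partners. *)
Lemma involution_conj m m' : involutive m -> (forall x, m x != x) ->
  involutive m' -> (forall x, m' x != x) ->
  exists p : {perm 'I_s}, forall x, p (m' x) = m (p x).
Proof.
move=> mK mn mK' mn'.
have E : #|lower m| = #|lower m'| by apply: double_inj; rewrite !card_lower.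
(* The k-th element of [lower m'] goes to the k-th of [lower m]; the default [x] is not read on
   [lower m']. *)
pose h x := nth x (enum (lower m)) (index x (enum (lower m'))).
have sz x : x \in lower m' -> index x (enum (lower m')) < size (enum (lower m)).
  by move=> xR; rewrite -cardE E cardE index_mem mem_enum.
have hR x : x \in lower m' -> h x \in lower m.
  by move=> xR; rewrite -mem_enum mem_nth // sz.
have hI x y : x \in lower m' -> y \in lower m' -> h x = h y -> x = y.
  move=> xR yR; rewrite /h (set_nth_default x y) ?sz // => /eqP.
  rewrite nth_uniq ?enum_uniq ?sz // => /eqP/(congr1 (nth x (enum (lower m')))).
  by rewrite !nth_index ?mem_enum.
pose p x := if x \in lower m' then h x else m (h (m' x)).
have pI : injective p.
  move=> x y; rewrite /p; case: ifP => xR; case: ifP => yR.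
  - exact: hI.
  - move=> hE; have := hR _ xR; rewrite hE lower_flip // hR //.
    by rewrite lower_flip // yR.
  - move=> hE; have := hR _ yR; rewrite -hE lower_flip // hR //.
    by rewrite lower_flip // xR.
  - move/(inv_inj mK)/hI => hE; apply: (inv_inj mK').
    by apply: hE; rewrite lower_flip // ?xR ?yR.
exists (perm pI) => x; rewrite !permE /p lower_flip // mK'.
by case: (x \in lower m'); rewrite /= ?mK.
Qed.
End Involutions.

Lemma reduced_partner s (D : qgraph s) : labeled D -> reduced D -> cubic D ->
  exists m, [/\ involutive m, forall x, m x != x &
    forall x y, aedge D x y = (m x == y)].
Proof.
move=> /eqP VD [lD tD _ _] cD.
pose m x := odflt x [pick y | aedge D x y].
have am x : aedge D x (m x).
  rewrite /m; case: pickP => [y //|none] /=.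
  have xV : x \in vertices D by rewrite VD inE.
  by have [y] := total_a tD xV; rewrite none.
have mE x y : aedge D x y = (m x == y).
  by apply/idP/eqP => [|<-//]; exact: (a_fun lD (am x)).
exists m; split=> // x.
  by apply/eqP; rewrite -mE; exact: (a_sym lD).
by rewrite -mE; exact: (cub_a cD).
Qed.

(** * Embedding labeled graphs into a larger label set *)

Section Embed.
Variables (s n : nat) (e : 'I_s -> 'I_n).
Hypothesis eI : injective e.
Implicit Types (D : qgraph s) (i j k : 'I_s).

Definition embed D : qgraph n :=
  QGraph (e @: vertices D) [set (e p.1, e p.2) | p in aedges D]
    [set (e p.1, e p.2) | p in bedges D].

Lemma embed_pairI : injective (fun p : 'I_s * 'I_s => (e p.1, e p.2)).
Proof. by case=> i j [i' j'] /= [/eI-> /eI->]. Qed.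

Lemma embed_aedge D i j : aedge (embed D) (e i) (e j) = aedge D i j.
Proof. exact: (mem_imset (aedges D) (i, j) embed_pairI). Qed.

Lemma embed_bedge D i j : bedge (embed D) (e i) (e j) = bedge D i j.
Proof. exact: (mem_imset (bedges D) (i, j) embed_pairI). Qed.

Lemma embed_vertex D i : (e i \in vertices (embed D)) = (i \in vertices D).
Proof. exact: mem_imset. Qed.

Variant image2_spec (r : rel 'I_s) x y : Prop :=
  Image2Spec i j of x = e i & y = e j & r i j.

Lemma embed_aedgeP D x y : aedge (embed D) x y -> image2_spec (aedge D) x y.
Proof. by case/imsetP => [[i j] a [-> ->]]; exact: Image2Spec. Qed.

Lemma embed_bedgeP D x y : bedge (embed D) x y -> image2_spec (bedge D) x y.
Proof. by case/imsetP => [[i j] a [-> ->]]; exact: Image2Spec. Qed.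

Lemma embed_iso_b D i j : iso_b D i j -> iso_b (embed D) (e i) (e j).
Proof.
case/iso_bP => ij b h; apply/iso_bP; rewrite embed_bedge (inj_eq eI); split=> //.
move=> _ _ /embed_bedgeP[k l -> -> b'] t; have [|-> ->] // := h _ _ b'.
by case: t => /eI; [constructor 1|constructor 2|constructor 3|constructor 4].
Qed.

Lemma embed_triangle D i j k :
  btriangle D i j k -> btriangle (embed D) (e i) (e j) (e k).
Proof.
case/btriangleP => ne b1 b2 b3; apply/btriangleP.
by rewrite !embed_bedge !(inj_eq eI).
Qed.

Lemma embed_reduced D : reduced D -> reduced (embed D).
Proof.
case=> lD tD cD /set0Pn[i iV]; split; last first.
- by apply/set0Pn; exists (e i); rewrite embed_vertex.
- move=> h [ha hb] _ _ /imsetP[k kV ->] /imsetP[l lV ->].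
  apply: (cD (fun i => h (e i))) => //.
  by split=> p q ?; [apply: ha; rewrite embed_aedge|apply: hb; rewrite embed_bedge].
- split=> _ /imsetP[k kV ->].
    by have [l a] := total_a tD kV; exists (e l); rewrite embed_aedge.
  by have [l b] := total_b tD kV; exists (e l); rewrite !embed_bedge.
- split=> [x y|x y|x y z|x y|x y|x y z|x y z|x y].
  + by case/embed_aedgeP=> p q -> _ a; rewrite embed_vertex (a_in lD a).
  + by case/embed_aedgeP=> p q -> -> a; rewrite embed_aedge (a_sym lD a).
  + case/embed_aedgeP=> p q -> -> a /embed_aedgeP[p' q' /eI<- -> a'].
    by rewrite (a_fun lD a a').
  + by case/embed_bedgeP=> p q -> _ a; rewrite embed_vertex (b_inl lD a).
  + by case/embed_bedgeP=> p q _ -> a; rewrite embed_vertex (b_inr lD a).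
  + case/embed_bedgeP=> p q -> -> a /embed_bedgeP[p' q' /eI<- -> a'].
    by rewrite (b_fun lD a a').
  + case/embed_bedgeP=> p q -> -> a /embed_bedgeP[p' q' -> /eI<- a'].
    by rewrite (b_inj lD a a').
  + case/embed_bedgeP=> p q -> -> /(b_type lD)[->|t|[z t]].
    * by constructor 1.
    * by constructor 2; exact: embed_iso_b.
    * by constructor 3; exists (e z); exact: embed_triangle.
Qed.

Lemma embed_cubic D : cubic D -> cubic (embed D).
Proof.
case=> ca cb; split=> [x|x y].
  apply/negP => /embed_aedgeP[i j E1 E2 a]; case/negP: (ca i).
  by rewrite /aloop {2}(eI (etrans (esym E1) E2)).
case/embed_bedgeP=> i j -> -> /cb[k t].
by exists (e k); exact: embed_triangle.
Qed.

Definition extend_perm (p : {perm 'I_s}) x :=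
  if [pick i | e i == x] is Some i then e (p i) else x.

Lemma extend_permE p i : extend_perm p (e i) = e (p i).
Proof.
rewrite /extend_perm; case: pickP => [j /eqP/eI-> //|/(_ i)].
by rewrite eqxx.
Qed.

Lemma extend_perm_out p x : (forall i, e i != x) -> extend_perm p x = x.
Proof. by move=> h; rewrite /extend_perm; case: pickP => // i; rewrite (negPf (h i)). Qed.

Lemma extend_permK (p q : {perm 'I_s}) : cancel p q -> cancel (extend_perm p) (extend_perm q).
Proof.
move=> pK x; case: (pickP (fun i => e i == x)) => [i /eqP<-|h].
  by rewrite !extend_permE pK.
by rewrite !extend_perm_out // => i; rewrite h.
Qed.

End Embed.

Section Enumeration.
Variables (s n : nat) (sn : s <= n).
Implicit Types (K : {set 'I_n}) (D : qgraph s) (H : qgraph n).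

(** The increasing enumeration of [K] when [#|K| = s]; the default merely supplies an element of
    ['I_n]. *)
Definition enum_emb K (i : 'I_s) : 'I_n := nth (widen_ord sn i) (enum K) i.

Lemma enum_emb_in K i : #|K| = s -> enum_emb K i \in K.
Proof. by move=> cK; rewrite -mem_enum mem_nth // -cardE cK. Qed.

Lemma enum_emb_inj K : #|K| = s -> injective (enum_emb K).
Proof.
move=> cK i j; have sz k : k < s -> k < size (enum K) by rewrite -cardE cK.
rewrite /enum_emb (set_nth_default (widen_ord sn i) (widen_ord sn j)) ?sz //.
by move/eqP; rewrite nth_uniq ?enum_uniq ?sz // => /eqP/val_inj.
Qed.

Lemma enum_emb_surj K x : #|K| = s -> x \in K -> exists i, enum_emb K i = x.
Proof.
move=> cK; rewrite -mem_enum => xK.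
have lt : index x (enum K) < s by rewrite -cK cardE index_mem.
by exists (Ordinal lt); rewrite /enum_emb /= nth_index.
Qed.

End Enumeration.

(** The type of [norm H] depends on the size of [H]. This trades an equality of tagged values for an
    equation between graphs on ['I_n]. *)
Lemma norm_eqP s n (sn : s <= n) (H : qgraph n) (D : qgraph s) :
  local_graph H -> #|vertices H| = s ->
  (Tagged qgraph (norm H) = Tagged qgraph D) <->
  (labeled D /\ H = embed (enum_emb sn (vertices H)) D).
Proof.
move=> lH cH; set K := vertices H in cH *.
have eI := enum_emb_inj (sn := sn) cH.
have VE : labeled D -> K = vertices (embed (enum_emb sn K) D).
  move=> /eqP VD; apply/setP => x; rewrite /= VD; apply/idP/imsetP => [|[i _ ->]].
    by case/(enum_emb_surj sn cH) => i <-; exists i; rewrite ?inE.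
  exact: enum_emb_in.
have normE : (Tagged qgraph (norm H) = Tagged qgraph D) <-> [/\ labeled D,
    forall i j, aedge D i j = aedge H (enum_emb sn K i) (enum_emb sn K j) &
    forall i j, bedge D i j = bedge H (enum_emb sn K i) (enum_emb sn K j)].
  (* Once [s] is literally the cardinal, both graphs have the same type and [enum_emb] is
     [enum_val]. *)
  rewrite {eI VE}/K in cH *; subst s.
  have ev i : enum_emb sn (vertices H) i = enum_val i by rewrite (enum_val_nth (widen_ord sn i)).
  split=> [/eqP|[VD Ea Eb]].
    rewrite eq_Tagged /= => /eqP <-; split; first exact: eqxx.
      by move=> i j; rewrite !ev /aedge inE.
    by move=> i j; rewrite !ev /bedge inE.
  congr Tagged; apply: eq_qgraph; first by rewrite (eqP VD).
    by move=> i j; rewrite Ea !ev /aedge inE.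
  by move=> i j; rewrite Eb !ev /bedge inE.
split=> [/normE[VD Ea Eb]|[VD EH]]; last first.
  by apply/normE; split=> // i j; rewrite {1}EH ?embed_aedge ?embed_bedge.
split=> //; apply: eq_qgraph; first exact: VE.
- move=> x y; apply/idP/idP => [a|/embed_aedgeP[i j -> ->]]; last by rewrite Ea.
  have [i Ei] := enum_emb_surj sn cH (a_in lH a).
  have [j Ej] := enum_emb_surj sn cH (a_in lH (a_sym lH a)).
  by rewrite -Ei -Ej embed_aedge // Ea Ei Ej.
- move=> x y; apply/idP/idP => [a|/embed_bedgeP[i j -> ->]]; last by rewrite Eb.
  have [i Ei] := enum_emb_surj sn cH (b_inl lH a).
  have [j Ej] := enum_emb_surj sn cH (b_inr lH a).
  by rewrite -Ei -Ej embed_bedge // Eb Ei Ej.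
Qed.

(** * Rooted graphs and their unrooting *)

Section Unroot.
Variable n : nat.
Implicit Types (G : qgraph n) (x y z u v w : 'I_n).

Lemma unroot_aedge G v x y :
  aedge (unroot G v) x y = aedge G x y || [&& ~~ has_aedge G v, x == v & y == v].
Proof.
rewrite /aedge /=; case: (has_aedge G v); first by rewrite orbF.
by rewrite !inE orbC xpair_eqE.
Qed.

Lemma unroot_bedge G v x y :
  bedge (unroot G v) x y = bedge G x y || [&& ~~ has_bedge G v, x == v & y == v].
Proof.
rewrite /bedge /=; case: (has_bedge G v); first by rewrite orbF.
by rewrite !inE orbC xpair_eqE.
Qed.

Lemma unroot_id G v : has_aedge G v -> has_bedge G v -> unroot G v = G.
Proof. by move=> ha hb; rewrite /unroot ha hb; case: G {ha hb}. Qed.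

Lemma has_bedgeN G v x : ~~ has_bedge G v -> bedge G v x = false /\ bedge G x v = false.
Proof. by move/existsPn/(_ x); rewrite negb_or => /andP[/negPf-> /negPf->]. Qed.

Lemma has_aedgeN G v x : ~~ has_aedge G v -> aedge G v x = false.
Proof. by move/existsPn/(_ x)/negPf. Qed.

Lemma unroot_conn G v : conn (unroot G v) <-> conn G.
Proof.
suff E h : edge_invariant (unroot G v) h <-> edge_invariant G h.
  by split=> c h /E; apply: c.
split=> [[ha hb]|[ha hb]]; split=> x y e.
- by apply: ha; rewrite unroot_aedge e.
- by apply: hb; rewrite unroot_bedge e.
- by move: e; rewrite unroot_aedge => /orP[/ha //|/and3P[_ /eqP-> /eqP->]].
- by move: e; rewrite unroot_bedge => /orP[/hb //|/and3P[_ /eqP-> /eqP->]].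
Qed.

Lemma unroot_local G v : v \in vertices G -> local_graph G -> local_graph (unroot G v).
Proof.
move=> vV lG; split=> [x y|x y|x y z|x y|x y|x y z|x y z|x y];
  rewrite ?unroot_aedge ?unroot_bedge.
- by case/orP=> [/(a_in lG)//|/and3P[_ /eqP->]].
- by case/orP=> [/(a_sym lG)-> //|/and3P[-> -> ->]]; rewrite orbT.
- case/orP=> [a|/and3P[h /eqP-> /eqP->]]; case/orP=> [a'|/and3P[h' /eqP E /eqP E']].
  + exact: (a_fun lG a a').
  + by subst; rewrite has_aedgeN in a.
  + by rewrite has_aedgeN in a'.
  + by subst.
- by case/orP=> [/(b_inl lG)//|/and3P[_ /eqP->]].
- by case/orP=> [/(b_inr lG)//|/and3P[_ _ /eqP->]].
- case/orP=> [a|/and3P[h /eqP-> /eqP->]]; case/orP=> [a'|/and3P[h' /eqP E /eqP E']].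
  + exact: (b_fun lG a a').
  + by subst; have [E _] := has_bedgeN y h'; rewrite E in a.
  + by have [E _] := has_bedgeN z h; rewrite E in a'.
  + by subst.
- case/orP=> [a|/and3P[h /eqP-> /eqP->]]; case/orP=> [a'|/and3P[h' /eqP E /eqP E']].
  + exact: (b_inj lG a a').
  + by subst; have [_ E] := has_bedgeN x h'; rewrite E in a.
  + by have [_ E] := has_bedgeN y h; rewrite E in a'.
  + by subst.
- case/orP=> [a|/and3P[_ /eqP-> /eqP->]]; last by constructor 1.
  case: (b_type lG a) => [->|i|[z t]]; first by constructor 1.
    constructor 2; case/iso_bP: i => xy b h; apply/iso_bP.
    rewrite unroot_bedge b; split=> // u w; rewrite unroot_bedge.
    case/orP=> [|/and3P[hv /eqP E /eqP E']]; first exact: h.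
    have [E1 _] := has_bedgeN y hv; have [_ E2] := has_bedgeN x hv.
    by subst u w; case=> E; subst v; rewrite ?b in E1 E2.
  constructor 3; exists z; case/btriangleP: t => ne b1 b2 b3; apply/btriangleP.
  by rewrite !unroot_bedge b1 b2 b3.
Qed.

Lemma unroot_local_inv G v : local_graph (unroot G v) -> local_graph G.
Proof.
move=> lU.
have sa x y : aedge G x y -> aedge (unroot G v) x y by rewrite unroot_aedge => ->.
have sb x y : bedge G x y -> bedge (unroot G v) x y by rewrite unroot_bedge => ->.
have bT x y : bedge (unroot G v) x y -> x != y -> bedge G x y.
  rewrite unroot_bedge => /orP[//|/and3P[_ /eqP-> /eqP->]].
  by rewrite eqxx.
split=> [x y|x y a|x y z|x y|x y|x y z|x y z|x y b].
- by move/sa/(a_in lU).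
- have := a_sym lU (sa _ _ a); rewrite unroot_aedge.
  case/orP=> // /and3P[hv /eqP E /eqP E']; subst.
  by rewrite has_aedgeN in a.
- by move=> /sa a /sa; exact: (a_fun lU).
- by move/sb/(b_inl lU).
- by move/sb/(b_inr lU).
- by move=> /sb a /sb; exact: (b_fun lU).
- by move=> /sb a /sb; exact: (b_inj lU).
- case: (b_type lU (sb _ _ b)) => [->|i|[z t]]; first by constructor 1.
    by constructor 2; apply: iso_b_mono i.
  constructor 3; exists z; case/btriangleP: t => [[xy yz xz] b1 b2 b3].
  by apply/btriangleP; rewrite !bT // eq_sym.
Qed.

Definition edgeless_point G :=
  [&& #|vertices G| == 1, aedges G == set0 & bedges G == set0].

(** This moves the whole argument to unrooted graphs. The exclusion of the edgeless point must
    remain as a separate condition, since that graph unroots to [Delta1]. *)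
Lemma rooted_reducedP G v : rooted_reduced G v <->
  [/\ v \in vertices G, reduced (unroot G v) & ~~ edgeless_point G].
Proof.
split=> [/and4P[/local_graphP[lG cG neG] vV /forallP t ne]|[vV [lU tU cU neU] ne]].
  split=> //; split=> //; first exact: unroot_local.
    split=> x xV; have [E|xv] := eqVneq x v.
    - subst x; case: (boolP (has_aedge G v)) => [/existsP[y a]|h].
        by exists y; rewrite unroot_aedge a.
      by exists v; rewrite unroot_aedge h !eqxx orbT.
    - have := t x; rewrite xV xv => /andP[/existsP[y a] _].
      by exists y; rewrite unroot_aedge a.
    - subst x; case: (boolP (has_bedge G v)) => [/has_bedgeP[y b]|h].
        by exists y; rewrite !unroot_bedge; case: b => ->; [left|right].
      by exists v; rewrite unroot_bedge h !eqxx orbT; left.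
    - have := t x; rewrite xV xv => /andP[_ /has_bedgeP[y b]].
      by exists y; rewrite !unroot_bedge; case: b => ->; [left|right].
  exact/unroot_conn.
apply/and4P; split=> //.
  apply/local_graphP; split=> //; first exact: unroot_local_inv lU.
  exact/(unroot_conn G v).
apply/forallP => x; apply/implyP => xV; apply/implyP => xv; apply/andP; split.
  have [y] := total_a tU xV; rewrite unroot_aedge (negPf xv) andbF orbF => a.
  by apply/existsP; exists y.
have [y b] := total_b tU xV; apply/has_bedgeP; exists y.
by move: b; rewrite !unroot_bedge (negPf xv) /= !andbF !orbF.
Qed.

End Unroot.

(** * Exchanging two silhouettes *)

Section UnrootTransfer.
Variables (n : nat) (G H H' : qgraph n) (v : 'I_n) (tau sigma : 'I_n -> 'I_n).
Let U := unroot G v.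
Hypotheses (rU : reduced U) (UH : connect (@move n) U H) (cH : cubic H).
Hypotheses (rH' : reduced H') (VH' : vertices H' = vertices H).
Hypotheses (tauK : cancel tau sigma) (sigmaK : cancel sigma tau).
Hypothesis tau_out : forall x, x \notin vertices H -> tau x = x.
Let K := vertices H.
Let rH := reach_reduced rU UH.

(** The flow 1 on [H] extends to [U], where an a-loop would make it vanish. *)
Lemma core_no_aloop x : x \in K -> ~~ aloop U x.
Proof.
move=> xK; apply/negP => l.
have [g sg gK] := core_flow_extend rU UH cH (f := fun=> (0, 1)) (fun=> isT)
  (fun _ _ _ => erefl).
by have := sol_aloop sg l; rewrite gK.
Qed.

Lemma core_no_bloop x : x \in K -> ~~ bloop U x.
Proof.
move=> xK; apply/negP; rewrite /bloop (core_b rU UH cH) // => b.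
by have [z /btriangleP[[]]] := cub_b cH b; rewrite eqxx.
Qed.

Lemma core_root_has_edges : v \in K -> has_aedge G v /\ has_bedge G v.
Proof.
move=> vK; split; apply: contraT => h.
  by have := core_no_aloop vK; rewrite /aloop unroot_aedge h eqxx orbT.
by have := core_no_bloop vK; rewrite /bloop unroot_bedge h eqxx orbT.
Qed.

Lemma core_unroot_b x y : x \in K -> bedge G x y = bedge H x y.
Proof.
move=> xK; rewrite -(core_b rU UH cH) // unroot_bedge.
case: (eqVneq x v) => [E|_]; last by rewrite andbF orbF.
by subst x; have [_ ->] := core_root_has_edges xK; rewrite orbF.
Qed.

(** If the root survives, it already has both kinds of edges and neither side adds a loop. Otherwise
    [tau] fixes it and its b-edges lie off [K], so the same loops are missing on both sides. *)
Lemma unroot_transfer :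
  unroot (transfer G H' tau) v = transfer U H' tau.
Proof.
have aT x y : aedge (transfer G H' tau) x y = aedge G (tau x) (tau y).
  by rewrite /aedge inE.
have bT G' x y : bedge (transfer G' H' tau) x y =
    bedge G' x y && (x \notin K) || bedge H' x y.
  by rewrite /bedge inE VH'.
have vU : tau v \in vertices U -> exists y, aedge U (tau v) y.
  exact: (total_a (red_total rU)).
have [vK|vK] := boolP (v \in K).
  have [ha hb] := core_root_has_edges vK.
  rewrite /U !unroot_id //.
    have tvK : tau v \in K by rewrite (tau_in tauK tau_out).
    have [y] := vU (subsetP (core_sub rU UH) _ tvK).
    rewrite /U unroot_id // => a; apply/existsP; exists (sigma y).
    by rewrite aT sigmaK.
  have vK' : v \in vertices H' by rewrite VH'.
  have [y e] := total_b (red_total rH') vK'.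
  apply/has_bedgeP; exists y; rewrite !bT.
  by case: e => ->; rewrite orbT; [left|right].
have tv := tau_out vK.
have tE x : (tau x == v) = (x == v) by rewrite -{1}tv (can_eq tauK).
have hE : has_aedge (transfer G H' tau) v = has_aedge G v.
  apply/existsP/existsP => -[y a].
    by exists (tau y); rewrite aT tv in a.
  by exists (sigma y); rewrite aT tv sigmaK.
have clG x y : bedge G x y -> (x \in K) = (y \in K).
  by move=> b; apply: (core_b_closed rU UH cH); rewrite unroot_bedge b.
have hB : has_bedge (transfer G H' tau) v = has_bedge G v.
  apply/has_bedgeP/has_bedgeP => -[y b]; exists y.
    move: b; rewrite !bT; case=> /orP[/andP[]|b]; [by left| |by right|].
      by have := b_inl (red_local rH') b; rewrite VH' (negPf vK).
    by have := b_inr (red_local rH') b; rewrite VH' (negPf vK).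
  by case: b => b; rewrite !bT b; [left; rewrite vK|right; rewrite (clG _ _ b) vK].
apply: eq_qgraph => // x y.
  by rewrite unroot_aedge hE aT /aedge inE /= -/(aedge _ _ _) unroot_aedge !tE.
rewrite unroot_bedge hB !bT unroot_bedge.
have [->|xv] := eqVneq x v; last by rewrite !andbF !orbF.
by rewrite vK !andbT orbAC.
Qed.

End UnrootTransfer.

Section Swap.
Variables (s n : nat) (sn : s <= n).
Implicit Types (D : qgraph s) (g : qgraph n * 'I_n).

Definition core g := vertices (qsilh (unroot g.1 g.2)).

Definition has_silh D g :=
  [/\ labeled g.1, rooted_reduced g.1 g.2, #|core g| = s &
    qsilh (unroot g.1 g.2) = embed (enum_emb sn (core g)) D].

Definition swap D' (p : {perm 'I_s}) g :=
  (transfer g.1 (embed (enum_emb sn (core g)) D')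
     (extend_perm (enum_emb sn (core g)) p), g.2).

Lemma rooted_silhP D g : labeled D ->
  reflect (has_silh D g)
    ((g \in Rset n s) && (rooted_silh g == Tagged qgraph D)).
Proof.
move=> LD; rewrite inE; apply: (iffP andP).
  case=> /and3P[lg rr _] /eqP E; have [_ rU _] := (rooted_reducedP _ _).1 rr.
  have [_ /red_local lS _] := qsilhP rU.
  have cs : #|core g| = s by have := congr1 tag E.
  by have [_ qE] := (norm_eqP sn D lS cs).1 E; split.
case=> lg rr cs qE; have [_ rU _] := (rooted_reducedP _ _).1 rr.
have [_ /red_local lS _] := qsilhP rU.
have E : rooted_silh g = Tagged qgraph D by apply/(norm_eqP sn D lS cs); split.
by rewrite lg rr E !eqxx.
Qed.

Section Conjugation.
Variables (D D' : qgraph s) (p : {perm 'I_s}).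
Hypotheses (LD : labeled D) (rD : reduced D) (cD : cubic D).
Hypotheses (LD' : labeled D') (rD' : reduced D') (cD' : cubic D').
Hypothesis pE : forall i j, aedge D' i j = aedge D (p i) (p j).

(** The same enumeration of the core embeds [D] and [D'], so normalizing the new quasi-silhouette
    gives [D']. Preservation of the core is what makes the exchange injective. *)
Lemma swap_silh g : has_silh D g -> has_silh D' (swap D' p g) /\
  core (swap D' p g) = core g.
Proof.
case: g => G v; set K := core (G, v); rewrite /swap -/K /=.
case=> /= LG rr cK qE; have [vV rU _] := (rooted_reducedP _ _).1 rr.
rewrite -/K in cK qE.
have [UH rH nn] := qsilhP rU; set H := qsilh _ in K UH rH nn cK qE *.
set e := enum_emb sn K in qE *; have eI : injective e := enum_emb_inj cK.
have cH : cubic H by rewrite qE; exact: embed_cubic.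
set H' := embed e D'; have rH' : reduced H' := embed_reduced eI rD'.
have cH' : cubic H' := embed_cubic eI cD'.
have VH' : vertices H' = vertices H.
  by rewrite qE /= (eqP LD) (eqP LD').
have tauK := extend_permK eI (permK p); have sigmaK := extend_permK eI (permKV p).
set tau := extend_perm e p in tauK sigmaK *.
set sigma := extend_perm e _ in tauK sigmaK.
have e_out x : x \notin vertices H -> forall i, e i != x.
  by move=> xK i; apply: contraNneq xK => <-; rewrite qE embed_vertex // (eqP LD) inE.
have tau_out x : x \notin vertices H -> tau x = x.
  by move=> xK; rewrite /tau extend_perm_out //; exact: e_out.
have e_in x : x \in vertices H -> exists i, x = e i.
  by rewrite qE => /imsetP[i _ ->]; exists i.
have tau_a x y : aedge H' x y = aedge H (tau x) (tau y).
  apply/idP/idP => [/embed_aedgeP[i j -> ->]|].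
    by rewrite /tau !(extend_permE eI) qE embed_aedge // -pE.
  rewrite {1}qE => /embed_aedgeP[i j E1 E2 a].
  have E i' z : tau z = e i' -> z = e ((p^-1)%g i').
    by move=> E; apply: (can_inj tauK); rewrite E /tau extend_permE // permKV.
  by rewrite (E _ _ E1) (E _ _ E2) embed_aedge // pE !permKV.
have uE := unroot_transfer rU UH cH rH' VH' tauK sigmaK tau_out.
have rT := transfer_reduced rU UH cH rH' cH' VH' tauK sigmaK tau_out tau_a.
have [TL _ nnL] := qsilhP rT.
have qT := transfer_normal_form rU UH cH rH' cH' VH' tauK sigmaK tau_out tau_a TL nnL.
have cE : core (transfer G H' tau, v) = K by rewrite /core uE qT VH'.
split=> //; split; rewrite ?cE //=; last by rewrite uE qT.
apply/rooted_reducedP; split=> //; first by rewrite uE.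
apply/negP => /and3P[/eqP V1 _ _].
(* The excluded rooted graph has one vertex, while here [n >= s > 2]. *)
have := cubic_card rD cD; rewrite (eqP LD) cardsT card_ord => s_gt2.
have nV : #|vertices G| = n by rewrite (eqP LG) cardsT card_ord.
by have := leq_trans s_gt2 sn; rewrite -nV V1.
Qed.

(** The image shows the core, hence the permutation to undo on the a-edges. The b-edges off the core
    are unchanged, and those on it are dictated by [D]. *)
Lemma swap_inj : {in [set g in Rset n s | rooted_silh g == Tagged qgraph D] &,
  injective (swap D' p)}.
Proof.
move=> g1 g2; rewrite inE => /(rooted_silhP _ LD) h1.
rewrite inE => /(rooted_silhP _ LD) h2 E.
have [_ c1] := swap_silh h1; have [_ c2] := swap_silh h2.
have Ec : core g1 = core g2 by rewrite -c1 -c2 E.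
case: g1 g2 h1 h2 E Ec {c1 c2} => [G1 v1] [G2 v2].
move=> [/= L1 rr1 cK q1] [/= L2 rr2 _ q2] [_ Ea Eb Ev] Ec; subst v2.
rewrite -Ec in Ea Eb q2; set K := core (G1, v1) in Ea Eb cK q1 q2 Ec.
set e := enum_emb sn K in Ea Eb q1 q2; have eI : injective e := enum_emb_inj cK.
have qE : qsilh (unroot G1 v1) = qsilh (unroot G2 v1) by rewrite q1 q2.
have [_ rU1 _] := (rooted_reducedP _ _).1 rr1.
have [_ rU2 _] := (rooted_reducedP _ _).1 rr2.
have [UH1 _ _] := qsilhP rU1; have [UH2 _ _] := qsilhP rU2.
have cH : cubic (qsilh (unroot G1 v1)) by rewrite q1; exact: embed_cubic.
have cH2 : cubic (qsilh (unroot G2 v1)) by rewrite q2; exact: embed_cubic.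
have sigmaK := extend_permK eI (permKV p).
congr pair; apply: eq_qgraph; first by rewrite (eqP L1) (eqP L2).
  move=> x y; move/setP: Ea => /(_ (extend_perm e (p^-1)%g x, extend_perm e (p^-1)%g y)).
  by rewrite !inE /= !sigmaK.
move=> x y; have [xK|xK] := boolP (x \in K).
  rewrite (core_unroot_b rU1 UH1 cH y xK) qE.
  by rewrite (core_unroot_b rU2 UH2 cH2) // -qE.
have KE : K = e @: vertices D' by rewrite {1}/K /core /= q1 /= (eqP LD) (eqP LD').
have nH' : bedge (embed e D') x y = false.
  apply/negP => /embed_bedgeP[i j xE _ _]; case/negP: xK.
  by rewrite KE xE imset_f // (eqP LD') inE.
move/setP: Eb => /(_ (x, y)); rewrite !inE /= -KE xK nH' !orbF !andbT.
by [].
Qed.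

Lemma swap_card_le :
  #|[set g in Rset n s | rooted_silh g == Tagged qgraph D]| <=
  #|[set g in Rset n s | rooted_silh g == Tagged qgraph D']|.
Proof.
rewrite -[X in X <= _](card_in_imset swap_inj); apply: subset_leq_card.
apply/subsetP => _ /imsetP[g gD ->]; rewrite inE in gD; rewrite inE.
have [hs _] := swap_silh (rooted_silhP _ LD gD).
exact/(rooted_silhP _ LD').
Qed.

End Conjugation.
End Swap.

(** * Comparison of the probabilities *)

Lemma reach_same_card N (G H : qgraph N) : reduced G ->
  connect (@move N) G H -> #|vertices H| = #|vertices G| -> H = G.
Proof.
move=> rG /connectP[[|G1 q] /=]; first by move=> _ ->.
case/andP=> m pth -> E; have [lG tG _ _] := rG.
have [l1 t1] := move_local lG tG m.
have r1 : connect (@move N) G1 (last G1 q) by apply/connectP; exists q.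
have := subset_leq_card (reach_vertices l1 t1 r1).
by rewrite E leqNgt (proper_card (move_vertices lG m)).
Qed.

(** Each move shrinks the vertex set, so a graph of the same size as its silhouette has undergone no
    move and is normal. *)
Lemma silhouetteP s (D : qgraph s) : D \in Dset s ->
  [/\ labeled D, reduced D & ~ nonnormal D].
Proof.
rewrite inE => /and3P[LD /reducedP rD /eqP/(congr1 tag) sD]; split=> //.
have [DS _ nn] := qsilhP rD; rewrite -(reach_same_card rD DS) //.
by rewrite (eqP LD) cardsT card_ord.
Qed.

Lemma cubic_conj s (D D' : qgraph s) : labeled D -> reduced D -> cubic D ->
  labeled D' -> reduced D' -> cubic D' ->
  exists p : {perm 'I_s}, forall i j, aedge D' i j = aedge D (p i) (p j).
Proof.
move=> LD rD cD LD' rD' cD'.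
have [m [mK mn mE]] := reduced_partner LD rD cD.
have [m' [mK' mn' mE']] := reduced_partner LD' rD' cD'.
have [p pE] := involution_conj mK mn mK' mn'; exists p => i j.
by rewrite mE mE' -pE (inj_eq perm_inj).
Qed.

Lemma labeled_card s (D : qgraph s) : labeled D -> #|vertices D| = s.
Proof. by move/eqP->; rewrite cardsT card_ord. Qed.

Lemma is_Delta1_card N (G : qgraph N) : is_Delta1 G -> #|vertices G| = 1.
Proof. by case/existsP=> v /eqP->; exact: Delta1_card. Qed.

Lemma is_Delta2_card N (G : qgraph N) : is_Delta2 G -> #|vertices G| = 2.
Proof. by case/existsP=> v /existsP[w /andP[vw /eqP->]]; exact: Delta2_card. Qed.

(** The right-hand side does not mention [D], so all silhouettes of this type give the same
    event. *)
Lemma same_silh_Delta1 s (D : qgraph s) X : is_Delta1 D ->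
  same_silh X (Tagged qgraph D) = is_Delta1 (tagged X).
Proof.
move=> D1; rewrite /same_silh /= D1 andbT.
have [->|_] /= := eqVneq X; first by rewrite D1.
case: (boolP (is_Delta2 D)) => [/is_Delta2_card|_]; last by rewrite andbF orbF.
by rewrite (is_Delta1_card D1).
Qed.

Lemma same_silh_Delta2 s (D : qgraph s) X : is_Delta2 D ->
  same_silh X (Tagged qgraph D) = is_Delta2 (tagged X).
Proof.
move=> D2; rewrite /same_silh /= D2 andbT.
have [->|_] /= := eqVneq X; first by rewrite D2.
case: (boolP (is_Delta1 D)) => [/is_Delta1_card|_]; last by rewrite andbF.
by rewrite (is_Delta2_card D2).
Qed.

Lemma same_silh_cubic s (D : qgraph s) X : reduced D -> cubic D ->
  same_silh X (Tagged qgraph D) = (X == Tagged qgraph D).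
Proof.
move=> rD cD; have c3 := cubic_card rD cD; rewrite /same_silh /=.
case: (boolP (is_Delta1 D)) => [/is_Delta1_card E|_]; first by rewrite E in c3.
case: (boolP (is_Delta2 D)) => [/is_Delta2_card E|_]; first by rewrite E in c3.
by rewrite !andbF !orbF.
Qed.

Lemma eq_unif_prob (T : finType) (S : {set T}) (P Q : pred T) :
  P =1 Q -> unif_prob S P = unif_prob S Q.
Proof.
move=> PQ; rewrite /unif_prob; suff -> : [set x in S | P x] = [set x in S | Q x] by [].
by apply/setP => x; rewrite !inE PQ.
Qed.

Lemma eq_card_unif_prob (T : finType) (S : {set T}) (P Q : pred T) :
  #|[set x in S | P x]| <= #|[set x in S | Q x]| ->
  #|[set x in S | Q x]| <= #|[set x in S | P x]| ->
  unif_prob S P = unif_prob S Q.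
Proof.
move=> PQ QP; rewrite /unif_prob.
suff -> : #|[set x in S | P x]| = #|[set x in S | Q x]| by [].
by apply/eqP; rewrite eqn_leq PQ.
Qed.

Theorem theorem3p9 (n s : nat) (s_ge1 : 1 <= s) (s_le_n : s <= n)
    (R_nonempty : Rset n s != set0) (D D' : qgraph s)
    (D_silh : D \in Dset s) (D'_silh : D' \in Dset s) :
  unif_prob (Rset n s) (fun g => same_silh (rooted_silh g) (Tagged qgraph D))
  = unif_prob (Rset n s) (fun g => same_silh (rooted_silh g) (Tagged qgraph D')).
Proof.
have [LD rD nD] := silhouetteP D_silh; have [LD' rD' nD'] := silhouetteP D'_silh.
have sz : #|vertices D| = #|vertices D'|.
  exact: etrans (labeled_card LD) (esym (labeled_card LD')).
(* The three types have sizes 1, 2 and more than 2, so [D] and [D'] are of the same type. *)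
case: (normal_cases rD nD) => tD; case: (normal_cases rD' nD') => tD'.
- by apply: eq_unif_prob => g; rewrite !same_silh_Delta1.
- by exfalso; move: sz; rewrite (is_Delta1_card tD) (is_Delta2_card tD').
- by exfalso; have := cubic_card rD' tD'; rewrite -sz (is_Delta1_card tD).
- by exfalso; move: sz; rewrite (is_Delta2_card tD) (is_Delta1_card tD').
- by apply: eq_unif_prob => g; rewrite !same_silh_Delta2.
- by exfalso; have := cubic_card rD' tD'; rewrite -sz (is_Delta2_card tD).
- by exfalso; have := cubic_card rD tD; rewrite sz (is_Delta1_card tD').
- by exfalso; have := cubic_card rD tD; rewrite sz (is_Delta2_card tD').
have E (X : qgraph s) (rX : reduced X) (cX : cubic X) := eq_unif_prob (Rset n s)
  (fun g => same_silh_cubic (rooted_silh g) rX cX).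
apply: (etrans (E D rD tD)); apply: (etrans _ (esym (E D' rD' tD'))).
have [p pE] := cubic_conj LD rD tD LD' rD' tD'.
have [q qE] := cubic_conj LD' rD' tD' LD rD tD.
apply: eq_card_unif_prob.
  exact: (swap_card_le s_le_n LD rD tD LD' rD' tD' pE).
exact: (swap_card_le s_le_n LD' rD' tD' LD rD tD qE).
Qed.
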